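(* Let $M$ be a Riemannian manifold of dimension $n$ with metric $g$, let $p\in M$, let $(e_1,\dots,e_n)$ be an orthonormal basis of the tangent space $M_p$, and let $x^1,\dots,x^n$ be the normal coordinates at $p$ defined by this basis. Then the second-order Taylor expansion at the origin of the metric coefficients is $$g_{ij}=g\Big(\frac{\partial}{\partial x^i},\frac{\partial}{\partial x^j}\Big)=\delta_{ij}-\frac13\sum_{h,k}R_{ihjk}\,x^hx^k+\cdots,$$ where the components $R_{ihjk}$ of the curvature tensor are evaluated at $p$ with respect to the basis $(e_i)$, and the dots denote terms of order at least three in $x$.
   Context: Normal coordinates at $p$ are given by $q\mapsto (x^i(q))$ with $q=\exp_p(\sum_i x^i e_i)$, for $q$ in a neighborhood of $p$, where $\exp_p$ is the exponential map of the Levi-Civita connection $D$. The curvature operator is $R_{XY}=D_{[X,Y]}-D_XD_Y+D_YD_X$, and $R_{ijhk}=g(R_{e_ie_j}e_h,e_k)$. With this sign convention the sectional curvature of the plane spanned by orthonormal $v,w$ is $g(R_{vw}v,w)$, so $R_{ijij}$ is the sectional curvature of the plane spanned by $e_i,e_j$ for $i\neq j$. *)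

(* Defs.v *)
From HB Require Import structures.
From mathcomp Require Import all_boot all_order all_algebra.
From mathcomp Require Import all_classical all_reals all_analysis.

Set Implicit Arguments.
Unset Strict Implicit.
Unset Printing Implicit Defensive.

Import Order.TTheory GRing.Theory Num.Theory.
Import numFieldNormedType.Exports.

Local Open Scope classical_set_scope.
Local Open Scope ring_scope.

(** C^oo on [O]: every iterated partial derivative is differentiable at every
    point of [O].  It is only used for open [O]; the values of [f] outside [O]
    do not matter. *)
Definition smooth_on (R : realType) (n : nat) (V : normedModType R)
    (O : set 'rV[R]_n) (f : 'rV[R]_n -> V) : Prop :=
  forall (s : seq 'I_n) (x : 'rV[R]_n), O x ->
    differentiable
      (foldr (fun i (h : 'rV[R]_n -> V) y => 'D_(delta_mx 0 i) h y) f s) x.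

(** A homeomorphism from an open subset of [T] onto an open subset of R^n.
    [cmap] and [cinv] are total functions that are meaningful only on [cdom]
    and on [cmap @` cdom] respectively. *)
Record chart (R : realType) (n : nat) (T : topologicalType) := Chart {
  cmap :> T -> 'rV[R]_n;
  cinv : 'rV[R]_n -> T;
  cdom : set T;
  cdom_open : open cdom;
  cimg_open : open (cmap @` cdom);
  cmapK : forall q, cdom q -> cinv (cmap q) = q;
  cmap_continuous : forall q, cdom q -> {for q, continuous cmap};
  cinv_continuous : forall x, (cmap @` cdom) x -> {for x, continuous cinv}
}.

Definition smooth_transition (R : realType) (n : nat) (T : topologicalType)
    (c c' : chart R n T) : Prop :=
  smooth_on (c @` (cdom c `&` cdom c')) (c' \o cinv c).

Record smooth_manifold (R : realType) (n : nat) := SmoothManifold {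
  carrier :> topologicalType;
  hausdorff_carrier : hausdorff_space carrier;
  second_countable_carrier : second_countable (T := carrier);
  atlas : set (chart R n carrier);
  atlas_cover : forall q : carrier, exists c, atlas c /\ cdom c q;
  atlas_compatible : forall c c', atlas c -> atlas c' -> smooth_transition c c';
  atlas_maximal : forall c,
    (forall c', atlas c' -> smooth_transition c c' /\ smooth_transition c' c) ->
    atlas c
}.

Section Manifold.
Variables (R : realType) (n : nat) (M : smooth_manifold R n).

Definition chart_at (q : M) : chart R n M := projT1 (cid (atlas_cover q)).

(** The tangent space at [q] is ['rV[R]_n]: a tangent vector at [q] is given
    by its components in the chart [chart_at q].  The two functions below
    change the components to and from another chart [c] around [q]. *)

Definition components (c : chart R n M) (q : M) (u : 'rV[R]_n) : 'rV[R]_n :=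
  'd (c \o cinv (chart_at q)) (chart_at q q) u.

Definition of_components (c : chart R n M) (q : M) (a : 'rV[R]_n) : 'rV[R]_n :=
  'd (chart_at q \o cinv c) (c q) a.

Definition vector_field := M -> 'rV[R]_n.

(** The vector field on [cdom c] with constant components [a] in [c]. *)
Definition const_field (c : chart R n M) (a : 'rV[R]_n) : vector_field :=
  fun q => of_components c q a.

Definition coord_field (c : chart R n M) (i : 'I_n) : vector_field :=
  const_field c (delta_mx 0 i).

Definition smooth_function (O : set M) (f : M -> R) : Prop :=
  forall c, atlas c -> smooth_on (c @` (cdom c `&` O)) (f \o cinv c).

Definition smooth_vector_field (O : set M) (X : vector_field) : Prop :=
  forall c, atlas c ->
    smooth_on (c @` (cdom c `&` O))
      (fun x => components c (cinv c x) (X (cinv c x))).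

Definition vderive (X : vector_field) (f : M -> R) : M -> R :=
  fun q => 'D_(X q) (f \o cinv (chart_at q)) (chart_at q q).

(** [X, Y] f = X (Y f) - Y (X f), where the components of [X, Y] at [q] are
    obtained by taking for f the coordinate functions of [chart_at q]. *)
Definition lie_bracket (X Y : vector_field) : vector_field :=
  fun q => \row_i
    (vderive X (vderive Y (fun r => chart_at q r 0 i)) q
     - vderive Y (vderive X (fun r => chart_at q r 0 i)) q).

Record riemannian_metric := RiemannianMetric {
  metric :> forall q : M, 'rV[R]_n -> 'rV[R]_n -> R;
  metric_sym : forall q u v, metric q u v = metric q v u;
  metric_linear : forall q a u v w,
    metric q (a *: u + v) w = a * metric q u w + metric q v w;
  metric_pos : forall q u, u != 0 -> 0 < metric q u u;
  metric_smooth : forall c, atlas c -> forall i j,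
    smooth_function (cdom c)
      (fun q => metric q (coord_field c i q) (coord_field c j q))
}.

(** [covd X Y] is D_X Y.  Vector fields are allowed to be smooth on an open
    subset [O] of [M] only, so that the same D applies to coordinate fields;
    nothing is required of [covd X Y] outside [O]. *)
Record connection := Connection {
  covd :> vector_field -> vector_field -> vector_field;
  covd_smooth : forall O X Y, open O ->
    smooth_vector_field O X -> smooth_vector_field O Y ->
    smooth_vector_field O (covd X Y);
  covd_local : forall O X X' Y Y', open O ->
    smooth_vector_field O X -> smooth_vector_field O X' ->
    smooth_vector_field O Y -> smooth_vector_field O Y' ->
    {in O, X =1 X'} -> {in O, Y =1 Y'} -> {in O, covd X Y =1 covd X' Y'};
  covd_linearl : forall O f X X' Y, open O -> smooth_function O f ->
    smooth_vector_field O X -> smooth_vector_field O X' ->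
    smooth_vector_field O Y ->
    {in O, covd (fun q => f q *: X q + X' q) Y =1
           fun q => f q *: covd X Y q + covd X' Y q};
  covd_additiver : forall O X Y Y', open O ->
    smooth_vector_field O X ->
    smooth_vector_field O Y -> smooth_vector_field O Y' ->
    {in O, covd X (fun q => Y q + Y' q) =1 fun q => covd X Y q + covd X Y' q};
  covd_leibniz : forall O f X Y, open O -> smooth_function O f ->
    smooth_vector_field O X -> smooth_vector_field O Y ->
    {in O, covd X (fun q => f q *: Y q) =1
           fun q => vderive X f q *: Y q + f q *: covd X Y q}
}.

Record levi_civita (g : riemannian_metric) (D : connection) : Prop :=
  LeviCivita {
  torsion_free : forall O X Y, open O ->
    smooth_vector_field O X -> smooth_vector_field O Y ->
    {in O, forall q, D X Y q - D Y X q = lie_bracket X Y q};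
  metric_compatible : forall O X Y Z, open O ->
    smooth_vector_field O X -> smooth_vector_field O Y ->
    smooth_vector_field O Z ->
    {in O, forall q, vderive X (fun r => g r (Y r) (Z r)) q =
                     g q (D X Y q) (Z q) + g q (Y q) (D X Z q)}
}.

(** R_{XY} Z = D_{[X,Y]} Z - D_X D_Y Z + D_Y D_X Z. *)
Definition curvature_operator (D : connection) (X Y Z : vector_field) :
    vector_field :=
  fun q => D (lie_bracket X Y) Z q - D X (D Y Z) q + D Y (D X Z) q.

(** R_{uv} w for tangent vectors at [p].  The curvature is tensorial, so the
    choice of vector fields around [p] extending [u], [v], [w] is immaterial. *)
Definition curvature_at (D : connection) (p : M) (u v w : 'rV[R]_n) :
    'rV[R]_n :=
  let ext := const_field (chart_at p) in
  curvature_operator D (ext u) (ext v) (ext w) p.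

(** R_{ijhk} = g(R_{e_i e_j} e_h, e_k) at [p]. *)
Definition curvature_component (g : riemannian_metric) (D : connection) (p : M)
    (e : 'I_n -> 'rV[R]_n) (i j h k : 'I_n) : R :=
  g p (curvature_at D p (e i) (e j) (e h)) (e k).

Definition smooth_curve (I : set R) (gam : R -> M) : Prop :=
  forall t, I t ->
    {for t, continuous gam} /\
    forall c, atlas c -> cdom c (gam t) ->
      forall k, derivable (derive1n k (c \o gam)) t 1.

Definition velocity (gam : R -> M) (t : R) : 'rV[R]_n :=
  derive1 (chart_at (gam t) \o gam) t.

(** The covariant derivative at time [t] of a vector field [V] along [gam]:
    if V = sum_j V^j d/dx^j in the coordinates x of the chart [c] around
    [gam t], it is
    sum_j (V^j)' d/dx^j + sum_(i,j) (x^i o gam)' V^j D_(d/dx^i) (d/dx^j).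
    Since [c] is [chart_at (gam t)], components at [gam t] are taken in [c]. *)
Definition covd_along (D : connection) (gam : R -> M) (V : R -> 'rV[R]_n)
    (t : R) : 'rV[R]_n :=
  let c := chart_at (gam t) in
  derive1 (fun s => components c (gam s) (V s)) t
  + \sum_i \sum_j (velocity gam t 0 i * V t 0 j)
                  *: D (coord_field c i) (coord_field c j) (gam t).

Definition geodesic (D : connection) (I : set R) (gam : R -> M) : Prop :=
  smooth_curve I gam /\
  forall t, I t -> covd_along D gam (velocity gam) t = 0.

(** The graph of exp_p: [is_exp D p v q] means that exp_p is defined at [v]
    and that exp_p v = q. *)
Definition is_exp (D : connection) (p : M) (v : 'rV[R]_n) (q : M) : Prop :=
  exists (a b : R) (gam : R -> M),
    [/\ a < 0, 1 < b & geodesic D `]a, b[%classic gam] /\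
    [/\ gam 0 = p, velocity gam 0 = v & gam 1 = q].

Definition orthonormal_basis (g : riemannian_metric) (p : M)
    (e : 'I_n -> 'rV[R]_n) : Prop :=
  (forall i j, g p (e i) (e j) = (i == j)%:R) /\
  (forall u, exists a : 'I_n -> R, u = \sum_i a i *: e i).

(** The coordinate system [x] around [p], with origin at [p], satisfies
    q = exp_p (sum_i x^i(q) e_i) on its domain.  (The condition [x p = 0]
    excludes the coordinates v of a neighbourhood of some v0 != 0 such that
    exp_p v0 = p.) *)
Definition normal_coordinates (D : connection) (p : M) (e : 'I_n -> 'rV[R]_n)
    (x : chart R n M) : Prop :=
  [/\ atlas x, cdom x p, x p = 0 &
      forall q, cdom x q -> is_exp D p (\sum_i x q 0 i *: e i) q].

Definition metric_coefficient (g : riemannian_metric) (x : chart R n M)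
    (i j : 'I_n) (y : 'rV[R]_n) : R :=
  let q := cinv x y in g q (coord_field x i q) (coord_field x j q).

End Manifold.

(* Main.v *)
(** In a chart, D is D_X Y = dY(X) + Gamma(X, Y), with Gamma symmetric because D
    has no torsion, and a geodesic is a solution of u'' = - Gamma_u(u', u').
    Geodesics with the same initial position and velocity agree on [0, 1]: the
    set of times at which they agree is open (uniqueness for the differential
    equation in a chart) and closed (M is Hausdorff).  Hence, in normal
    coordinates, the geodesic that reaches y at time 1 is t |-> t y, so that
    Gamma_y(y, y) = 0 near 0 and the coordinate frame at p is (e_i).  It follows
    that Gamma vanishes at 0 and that the cyclic sum of d_l Gamma_ij at 0 is 0.
    At 0 one then has R_ihjk = d_h Gamma_ij^k - d_i Gamma_hj^k, while metric
    compatibility gives d_k g_ij = 0 and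
    d_b d_a g_ij = d_b Gamma_ai^j + d_b Gamma_aj^i; by the symmetry of second
    derivatives and the cyclic identity this Hessian is
    - (R_iajb + R_ibja) / 3.  Taylor's formula concludes. *)
Require Import Defs.
From HB Require Import structures.
From mathcomp Require Import all_boot all_order all_algebra.
From mathcomp Require Import all_classical all_reals all_analysis.
From mathcomp Require Import ring lra.

Set Implicit Arguments.
Unset Strict Implicit.
Unset Printing Implicit Defensive.

Import Order.TTheory GRing.Theory Num.Theory.
Import numFieldNormedType.Exports.

Local Open Scope classical_set_scope.
Local Open Scope ring_scope.

(** * Calculus in R^n *)

(** A chart is a total map that is meaningful on an open set only, and D is given by axioms on
    vector fields over open sets. Computations therefore concern germs: formulas are carried across
    equalities that hold near a point.

    Uniqueness of geodesics is needed because [is_exp] provides, for each y, some geodesic of its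
    own; that the geodesic for t y is a piece of the one for y is not part of the definition.

    [curvature_at] extends vectors by fields that are constant in [chart_at p], not in the normal
    chart. The curvature at the origin is therefore computed for arbitrary smooth fields, whose
    first and second derivatives cancel.

    The factor 1/3: by the cyclic identity, R_ihjk + R_jhik = 2 d_h Gamma_ij^k - d_i Gamma_hj^k -
    d_j Gamma_hi^k is 3 d_h Gamma_ij^k. When d_b Gamma_ai^j + d_b Gamma_aj^i is rewritten in this
    way, R_abij + R_abji drops out; its vanishing is exactly the symmetry d_a d_b g_ij = d_b d_a
    g_ij. *)

Lemma near_eq_differentiable (R : numFieldType) (V W : normedModType R)
    (f g : V -> W) (a : V) :
  (\near a, f a = g a) -> differentiable f a -> differentiable g a.
Proof.
move=> fg df.
have fa : f a = g a by exact: nbhs_singleton fg.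
(* The first-order expansion of [f] at [a] is also one of [g]; [diff_unique] then identifies the
   chosen differential of [g] with that of [f]. *)
have key : g \o shift a = cst (g a) + 'd f a +o_ 0 id.
  have /diff_locally df0 := df.
  apply/eqaddoP => eps eps0.
  have /eqaddoP /(_ eps eps0) := df0.
  apply: filter_app.
  have : \forall h \near (0 : V), f (h + a) = g (h + a).
    have : \forall y \near a, f y = g y by [].
    rewrite (near_shift 0) /=.
    by apply: filterS => h /=; rewrite subr0.
  apply: filterS => h /= E.
  rewrite -[X in `|X| <= _ -> _]/(f (h + a) - (f a + 'd f a h)).
  rewrite -[X in _ -> `|X| <= _]/(g (h + a) - (g a + 'd f a h)).
  by rewrite E fa.
have dE : 'd g a = 'd f a :> (V -> W).
  by apply: diff_unique key; exact: diff_continuous.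
by apply/diff_locallyP; rewrite dE; split => //; exact: diff_continuous.
Qed.

Lemma derive_comp (R : numFieldType) (U V W : normedModType R)
    (f : U -> V) (g : V -> W) (x v : U) :
  differentiable f x -> differentiable g (f x) ->
  'D_v (g \o f) x = 'D_('D_v f x) g (f x).
Proof.
move=> df dg; have dgf := differentiable_comp df dg.
by rewrite (deriveE v dgf) (deriveE v df) (deriveE _ dg) diff_comp.
Qed.

Section derive_linear.
Variables (R : numFieldType) (V W : normedModType R) (f : V -> W) (x : V).
Hypothesis df : differentiable f x.

Lemma derive_dirD u v : 'D_(u + v) f x = 'D_u f x + 'D_v f x.
Proof. by rewrite !(deriveE _ df) linearD. Qed.

Lemma derive_dirZ k u : 'D_(k *: u) f x = k *: 'D_u f x.
Proof. by rewrite !(deriveE _ df) linearZ. Qed.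

Lemma derive_dir_sum I (r : seq I) (P : pred I) (u : I -> V) :
  'D_(\sum_(i <- r | P i) u i) f x = \sum_(i <- r | P i) 'D_(u i) f x.
Proof.
rewrite (deriveE _ df) linear_sum; apply: eq_bigr => i _; by rewrite (deriveE _ df).
Qed.
End derive_linear.

Lemma derive_coord (R : numFieldType) n (W : normedModType R)
    (f : 'rV[R]_n -> W) (x v : 'rV[R]_n) : differentiable f x ->
  'D_v f x = \sum_i v 0 i *: 'D_(delta_mx 0 i) f x.
Proof.
move=> df; rewrite {1}(row_sum_delta v) derive_dir_sum //.
by apply: eq_bigr => i _; rewrite derive_dirZ.
Qed.

Lemma differentiable_rowP (R : realFieldType) (V : normedModType R) n
    (f : V -> 'rV[R]_n) (x : V) :
  differentiable f x <-> forall i, differentiable (fun y => f y 0 i) x.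
Proof.
split=> [df i|df].
  exact: (differentiable_comp df (differentiable_coord (f x) 0 i)).
have -> : f = \sum_(i < n) (fun y => f y 0 i *: delta_mx 0 i).
  by apply/funext => y; rewrite fct_sumE [LHS]row_sum_delta.
apply: differentiable_sum => i.
exact: differentiableZl.
Qed.

Lemma derive_row (R : realFieldType) (V : normedModType R) n
    (f : V -> 'rV[R]_n) (x v : V) i : derivable f x v ->
  ('D_v f x) 0 i = 'D_v (fun y => f y 0 i) x.
Proof. by move=> df; rewrite derive_mx // mxE. Qed.

Lemma derive_rowd (R : realFieldType) (V : normedModType R) n
    (f : V -> 'rV[R]_n) (x v : V) i : differentiable f x ->
  ('D_v f x) 0 i = 'D_v (fun y => f y 0 i) x.
Proof. by move=> df; apply: derive_row; exact: diff_derivable. Qed.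

(** * Differentiability of finite order *)

Section Ck.
Variables (R : realType) (n : nat).
Implicit Types (O : set 'rV[R]_n).

Definition pderive (V : normedModType R) i (f : 'rV[R]_n -> V) : 'rV[R]_n -> V :=
  fun y => 'D_(delta_mx 0 i) f y.

(** A version of [smooth_on] graded by the order, so that the product and chain rules go by
    induction on [k]. The index is off by one: the partial derivatives of order at most [k] are
    differentiable, and [Ck 0] is plain differentiability. *)
Fixpoint Ck (V : normedModType R) k O (f : 'rV[R]_n -> V) : Prop :=
  (forall x, O x -> differentiable f x) /\
  if k is k.+1 then forall i, Ck k O (pderive i f) else True.

Lemma smooth_onP (V : normedModType R) O (f : 'rV[R]_n -> V) :
  smooth_on O f <-> forall k, Ck k O f.
Proof.
split.
  move=> sf k; elim: k f sf => [|k IH] f sf /=.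
    by split=> // x Ox; exact: (sf [::] x Ox).
  split=> [x Ox|i]; first exact: (sf [::] x Ox).
  apply: IH => s x Ox.
  (* [Ck] peels off the innermost derivative, which is the last letter of the word. *)
  by have := sf (rcons s i) x Ox; rewrite foldr_rcons.
move=> cf s x Ox.
elim/last_ind: s f cf => [|s i IH] f cf /=; first by have [+ _] := cf 0%N; apply.
rewrite foldr_rcons; apply: IH => k.
by have [_] := cf k.+1; apply.
Qed.

Lemma CkP (V : normedModType R) k O (f : 'rV[R]_n -> V) :
  Ck k O f -> forall x, O x -> differentiable f x.
Proof. by case: k => [[]|k []]. Qed.

Lemma CkW (V : normedModType R) k O (f : 'rV[R]_n -> V) :
  Ck k.+1 O f -> Ck k O f.
Proof.
elim: k f => [|k IH] f [df cf]; split => // i; exact: IH (cf i).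
Qed.

Lemma pderive_ext (V : normedModType R) O i (f g : 'rV[R]_n -> V) : open O ->
  (forall x, O x -> f x = g x) -> forall x, O x -> pderive i f x = pderive i g x.
Proof.
move=> oO fg x Ox; apply: near_eq_derive.
by apply: filterS fg _; exact: open_nbhs_nbhs.
Qed.

Lemma Ck_ext (V : normedModType R) k O (f g : 'rV[R]_n -> V) : open O ->
  (forall x, O x -> f x = g x) -> Ck k O f -> Ck k O g.
Proof.
move=> oO; elim: k f g => [|k IH] f g fg [df cf]; split => //.
- move=> x Ox; apply: near_eq_differentiable (df _ Ox).
  by apply: filterS fg _; exact: open_nbhs_nbhs.
- move=> x Ox; apply: near_eq_differentiable (df _ Ox).
  by apply: filterS fg _; exact: open_nbhs_nbhs.
- move=> i; apply: IH (cf i) => x Ox.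
  exact: (pderive_ext i oO fg).
Qed.

Lemma Ck_cst (V : normedModType R) k O (a : V) : Ck k O (cst a).
Proof.
elim: k a => [|k IH] a; split => //.
move=> i.
have -> : pderive i (cst a) = cst 0 by apply/funext => y; rewrite /pderive derive_cst.
exact: IH.
Qed.

Lemma CkD (V : normedModType R) k O (f g : 'rV[R]_n -> V) : open O ->
  Ck k O f -> Ck k O g -> Ck k O (fun y => f y + g y).
Proof.
move=> oO.
elim: k f g => [|k IH] f g [df cf] [dg cg]; split => //.
- by move=> x Ox; apply: differentiableD; [exact: df|exact: dg].
- by move=> x Ox; apply: differentiableD; [exact: df|exact: dg].
- move=> i.
  apply: Ck_ext (IH _ _ (cf i) (cg i)) => // x Ox.
  by rewrite /pderive deriveD //; apply: diff_derivable; [exact: df|exact: dg].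
Qed.

Lemma CkM k O (f g : 'rV[R]_n -> R) : open O ->
  Ck k O f -> Ck k O g -> Ck k O (fun y => f y * g y).
Proof.
move=> oO.
elim: k f g => [|k IH] f g cf cg.
  split=> // x Ox; apply: differentiableM; [exact: (CkP cf)|exact: (CkP cg)].
split=> [x Ox|i].
  apply: differentiableM; [exact: (CkP cf)|exact: (CkP cg)].
have [df cf'] := cf; have [dg cg'] := cg.
apply: Ck_ext (CkD oO (IH _ _ (CkW cf) (cg' i)) (IH _ _ (CkW cg) (cf' i))) => // x Ox.
by rewrite /pderive deriveM //; apply: diff_derivable; [exact: df|exact: dg].
Qed.

Lemma Ck_sum (V : normedModType R) k O I (r : seq I) (f : I -> 'rV[R]_n -> V) :
  open O -> (forall i, Ck k O (f i)) -> Ck k O (fun y => \sum_(i <- r) f i y).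
Proof.
move=> oO cf; elim: r => [|a r IH].
  by apply: Ck_ext (@Ck_cst V k O 0) => // x _; rewrite big_nil.
by apply: Ck_ext (CkD oO (cf a) IH) => // x _; rewrite big_cons.
Qed.

Lemma Ck_rowP m k O (f : 'rV[R]_n -> 'rV[R]_m) : open O ->
  Ck k O f <-> forall i, Ck k O (fun y => f y 0 i).
Proof.
move=> oO; elim: k f => [|k IH] f; split.
- by move=> [df _] i; split=> // x Ox; move/(_ _ Ox)/differentiable_rowP : df.
- by move=> df; split => // x Ox; apply/differentiable_rowP => i; exact: (CkP (df i)).
- move=> [df cf] i; split=> [x Ox|j].
    by move/(_ _ Ox)/differentiable_rowP : df.
  have /IH/(_ i) := cf j; apply: Ck_ext => // x Ox.
  by rewrite /pderive derive_rowd //; exact: df.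
- move=> df.
  have dfx x : O x -> differentiable f x.
    by move=> Ox; apply/differentiable_rowP => i; exact: (CkP (df i)).
  split => // j; apply/IH => i.
  have [_ /(_ j)] := df i; apply: Ck_ext => // x Ox.
  by rewrite /pderive derive_rowd //; exact: dfx.
Qed.
End Ck.

(** By the chain rule, a partial derivative of the composite is a sum of products of partial
    derivatives of [phi] with composites [pderive j f \o phi]. In these [f] has lost one order, and
    [phi] is weakened to the same order by [CkW]. *)
Lemma Ck_comp (R : realType) n m k (O : set 'rV[R]_n) (O' : set 'rV[R]_m)
    (f : 'rV[R]_m -> R) (phi : 'rV[R]_n -> 'rV[R]_m) :
  open O -> open O' -> (forall x, O x -> O' (phi x)) ->
  Ck k O phi -> Ck k O' f -> Ck k O (f \o phi).
Proof.
move=> oO oO' OO'; elim: k f phi OO' => [|k IH] f phi OO' cphi cf.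
  split=> // x Ox; apply: differentiable_comp; [exact: (CkP cphi)|].
  by apply: (CkP cf); exact: OO'.
split=> [x Ox|i].
  apply: differentiable_comp; [exact: (CkP cphi)|].
  by apply: (CkP cf); exact: OO'.
have [dphi cphi'] := cphi; have [df cf'] := cf.
suff : Ck k O (fun y => \sum_(j < m) pderive i phi y 0 j * pderive j f (phi y)).
  apply: Ck_ext => // x Ox.
  have dx := dphi _ Ox; have dfx := df _ (OO' _ Ox).
  by rewrite /pderive (derive_comp _ dx dfx) [RHS](derive_coord _ dfx).
apply: Ck_sum => // j; apply: CkM => //.
  exact: ((Ck_rowP k _ oO).1 (cphi' i)).
by apply: IH => //; [exact: CkW cphi|exact: cf'].
Qed.

(** * Mean value theorem on segments and symmetry of second derivatives *)

Lemma nbhsI (T : topologicalType) (a : T) (P Q : T -> Prop) :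
  (\forall x \near a, P x) -> (\forall x \near a, Q x) ->
  \forall x \near a, P x /\ Q x.
Proof. exact: filterI. Qed.

Lemma near_dist_lt (R : realFieldType) (T : topologicalType) (V : normedModType R)
    (f : T -> V) (a : T) (e : R) :
  {for a, continuous f} -> 0 < e -> \forall y \near a, `|f a - f y| < e.
Proof. by move=> cf e0; have /cvgrPdist_lt/(_ _ e0) := cf. Qed.

Lemma is_derive_line (R : realFieldType) (V : normedModType R) (a v : V) (s : R) :
  is_derive s 1 (fun s : R => a + s *: v) v.
Proof.
have d : differentiable (fun s : R => s *: v) s by exact: differentiableZl.
have -> : (fun s : R => a + s *: v) = cst a + (fun s : R => s *: v) by [].
have dd : differentiable (cst a + (fun s : R => s *: v)) s.
  by apply: differentiableD.
apply: DeriveDef; first exact: diff_derivable.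
rewrite deriveD; [|exact: diff_derivable|exact: diff_derivable].
rewrite derive_cst add0r (deriveE _ d).
by rewrite (@diff_val _ _ _ _ _ _ _ (is_diff_scalel s v)) scale1r.
Qed.

Lemma differentiable_line (R : realFieldType) (V : normedModType R) (a v : V) (s : R) :
  differentiable (fun s : R => a + s *: v) s.
Proof. by apply/derivable1_diffP; have [] := is_derive_line a v s. Qed.

Lemma MVT_line (R : realType) (V : normedModType R) (f : V -> R) (a v : V) :
  (forall c : R, 0 <= c <= 1 -> differentiable f (a + c *: v)) ->
  exists2 c : R, 0 <= c <= 1 & f (a + v) - f a = 'D_v f (a + c *: v).
Proof.
move=> df.
have d (c : R) : 0 <= c <= 1 ->
    is_derive c 1 (fun s : R => f (a + s *: v)) ('D_v f (a + c *: v)).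
  move=> c01; have dl := differentiable_line a v c.
  have dfc := df _ c01.
  have dc : differentiable (f \o (fun s : R => a + s *: v)) c.
    exact: (differentiable_comp dl).
  apply: DeriveDef; first exact: (diff_derivable dc).
  rewrite -[X in 'D__ X _]/(f \o (fun s : R => a + s *: v)).
  by rewrite (derive_comp _ dl dfc) (@derive_val _ _ _ _ _ _ _ (is_derive_line a v c)).
have [||c] := @MVT_segment R (fun s : R => f (a + s *: v))
    (fun c => 'D_v f (a + c *: v)) 0 1 ler01.
- move=> c; rewrite in_itv /= => /andP[c0 c1]; apply: d; by rewrite !ltW.
- apply: derivable_within_continuous => c; rewrite in_itv /= => c01.
  by have [] := d c c01.
rewrite in_itv /= => c01; rewrite scale1r scale0r addr0 subr0 mulr1 => E.
by exists c.
Qed.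

(** The mean value theorem is used twice: along [u] for y |-> f(y + v) - f(y), then along [v] for
    the derivative of [f] in the direction [u]. The second difference on the left is symmetric in
    [u] and [v] while the right side is not; [schwarz] exploits this. *)
Lemma MVT_rectangle (R : realType) (V : normedModType R) (O : set V)
    (f : V -> R) (a u v : V) :
  (forall s t : R, 0 <= s <= 1 -> 0 <= t <= 1 -> O (a + s *: u + t *: v)) ->
  (forall y, O y -> differentiable f y) ->
  (forall y, O y -> differentiable ('D_u f) y) ->
  exists s t : R, [/\ 0 <= s <= 1, 0 <= t <= 1 &
    f (a + u + v) - f (a + u) - (f (a + v) - f a)
    = 'D_v ('D_u f) (a + s *: u + t *: v)].
Proof.
move=> OO df ddf.
pose F := fun y => f (y + v) - f y.
have i01 : (0 : R) <= (1 : R) <= 1 by apply/andP; split.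
have i00 : (0 : R) <= (0 : R) <= 1 by apply/andP; split.
have dsh y : differentiable (fun y : V => y + v) y.
  have -> : (fun y : V => y + v) = id + cst v by [].
  exact: differentiableD.
have Dsh y w : 'D_w (fun y : V => y + v) y = w.
  have -> : (fun y : V => y + v) = id + cst v by [].
  by rewrite deriveD // derive_id derive_cst addr0.
have dFF s : 0 <= s <= 1 ->
    differentiable (f \o (fun y => y + v)) (a + s *: u) /\ differentiable f (a + s *: u).
  move=> s01; split.
    apply: differentiable_comp; first exact: dsh.
    apply: df; have := OO s 1 s01 i01; by rewrite scale1r.
  by apply: df; have := OO s 0 s01 i00; rewrite scale0r addr0.
have dF s : 0 <= s <= 1 -> differentiable F (a + s *: u).
  by move=> s01; have [? ?] := dFF s s01; apply: differentiableB.
have [s s01 Es] := MVT_line dF.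
have ddl t : 0 <= t <= 1 -> differentiable ('D_u f) (a + s *: u + t *: v).
  by move=> t01; apply: ddf; exact: OO.
have [t t01 Et] := MVT_line ddl.
exists s, t; split => //.
rewrite -Et -[LHS]/(F (a + u) - F a) Es.
have [d1 d2] := dFF s s01.
have -> : F = (f \o (fun y => y + v)) - f by [].
rewrite deriveB; [|exact: diff_derivable|exact: diff_derivable].
congr (_ - _).
rewrite derive_comp ?Dsh //.
by apply: df; have := OO s 1 s01 i01; rewrite scale1r.
Qed.

(** The second difference of [f] over a small parallelogram at [a] equals both mixed derivatives,
    each taken at a point of its own; by continuity each of these values is within e / 2 of the
    value at [a]. *)
Lemma schwarz (R : realType) (V : normedModType R) (O : set V)
    (f : V -> R) (a u v : V) : open O -> O a ->
  (forall y, O y -> differentiable f y) ->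
  (forall y, O y -> differentiable ('D_u f) y) ->
  (forall y, O y -> differentiable ('D_v f) y) ->
  {for a, continuous ('D_v ('D_u f))} -> {for a, continuous ('D_u ('D_v f))} ->
  'D_v ('D_u f) a = 'D_u ('D_v f) a.
Proof.
move=> oO Oa df du dv cvu cuv.
apply/eqP; rewrite -subr_eq0 -normr_le0; apply/ler_addgt0Pl => e e0.
rewrite addr0.
have e20 : 0 < e / 2 by rewrite divr_gt0.
have : \forall y \near a, [/\ O y, `|'D_v ('D_u f) a - 'D_v ('D_u f) y| < e / 2
    & `|'D_u ('D_v f) a - 'D_u ('D_v f) y| < e / 2].
  have h1 := near_dist_lt cvu e20.
  have h2 := near_dist_lt cuv e20.
  have h3 : \forall y \near a, O y by exact: open_nbhs_nbhs.
  have := nbhsI h3 (nbhsI h1 h2); apply: filterS => y [y1 [y2 y3]]; exact: And3 y1 y2 y3.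
move=> /nbhs_ballP[d /= d0 Hd].
have k0 : 0 < `|u| + `|v| + 1 by rewrite ltr_wpDl // addr_ge0.
(* The parallelogram is shrunk to the sides [h *: u] and [h *: v] so as to fit in the ball. The
   summand 1 keeps the divisor positive and the inclusion strict even if [u] and [v] are 0. *)
have [h h0 hE] : exists2 h : R, 0 < h & d = h * (`|u| + `|v| + 1).
  by exists (d / (`|u| + `|v| + 1)); rewrite ?divr_gt0 // divfK // gt_eqF.
have Pd (s t : R) : 0 <= s <= 1 -> 0 <= t <= 1 -> ball a d (a + s *: (h *: u) + t *: (h *: v)).
  move=> /andP[s0 s1] /andP[t0 t1]; rewrite -ball_normE /=.
  rewrite -addrA opprD addrA subrr sub0r normrN.
  apply: le_lt_trans (ler_normD _ _) _.
  rewrite !normrZ (ger0_norm s0) (ger0_norm t0) (gtr0_norm h0).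
  rewrite [ltRHS]hE.
  apply: (@le_lt_trans _ _ (h * (`|u| + `|v|))).
    rewrite mulrDr lerD //; apply: ler_piMl => //; by rewrite mulr_ge0 // ltW.
  by rewrite ltr_pM2l // ltrDl.
have Dh w : (forall y, O y -> differentiable ('D_w f) y) ->
    forall y, O y -> differentiable ('D_(h *: w) f) y /\
    (\near y, 'D_(h *: w) f y = h *: ('D_w f y)).
  move=> dw y Oy.
  have E : \near y, 'D_(h *: w) f y = h *: ('D_w f y).
    have : \forall z \near y, O z by exact: open_nbhs_nbhs.
    by apply: filterS => z /df dz; rewrite (derive_dirZ dz).
  split => //.
  apply: (@near_eq_differentiable _ _ _ (fun y => h *: 'D_w f y)).
    by apply: filterS E => z.
  by apply: differentiableZ; exact: dw.
have DDh w w' y : (forall y, O y -> differentiable ('D_w f) y) -> O y ->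
    'D_(h *: w') ('D_(h *: w) f) y = h * h * 'D_w' ('D_w f) y.
  move=> dw Oy; have [d1 E] := Dh w dw y Oy.
  rewrite (derive_dirZ d1) (near_eq_derive _ E).
  rewrite -[X in 'D__ X y]/(h *: ('D_w f)) deriveZ; last exact: diff_derivable (dw _ Oy).
  by rewrite !scalerA.
have [||s [t [s01 t01 Est]]] := @MVT_rectangle R V O f a (h *: u) (h *: v) _ df.
- by move=> s t s01 t01; have [] := Hd _ (Pd s t s01 t01).
- by move=> y Oy; have [] := Dh u du y Oy.
have [||t1 [s1 [t101 s101 Ets]]] := @MVT_rectangle R V O f a (h *: v) (h *: u) _ df.
- by move=> s2 t2 s01' t01'; rewrite addrAC; have [] := Hd _ (Pd t2 s2 t01' s01').
- by move=> y Oy; have [] := Dh v dv y Oy.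
have [y1O A1 _] := Hd _ (Pd s t s01 t01).
have [y2O _ A2] := Hd _ (Pd s1 t1 s101 t101).
rewrite DDh // in Est.
rewrite [X in 'D__ _ X]addrAC DDh // in Ets.
(* Rescaling the sides multiplies both mixed derivatives by the same [h * h], which cancels. *)
have : 'D_v ('D_u f) (a + s *: (h *: u) + t *: (h *: v)) =
       'D_u ('D_v f) (a + s1 *: (h *: u) + t1 *: (h *: v)).
  apply: (@mulfI _ (h * h)); first by rewrite mulf_neq0 // gt_eqF.
  apply: etrans (esym Est) _; apply: etrans _ Ets; rewrite (addrAC a (h *: v)).
  have X (p q r w : R) : p - q - (r - w) = p - r - (q - w) by ring.
  exact: X.
move=> E; rewrite E in A1; move: A1 A2; clear.
move: ('D_v _ a) ('D_u ('D_v f) a) ('D_u _ _) => A B C h1 h2.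
rewrite (_ : A - B = (A - C) - (B - C)); last by ring.
by apply: le_trans (ler_normB _ _) _; rewrite ltW // (splitr e) ltrD.
Qed.

(** * Bounds near a point: orders of vanishing and Lipschitz constants *)

Lemma nbhs_forall (T : topologicalType) (I : finType) (a : T) (P : I -> T -> Prop) :
  (forall i, \forall x \near a, P i x) -> \forall x \near a, forall i, P i x.
Proof. exact: filter_forall. Qed.

Lemma near_eq_continuous (T U : topologicalType) (f g : T -> U) (a : T) :
  (\forall x \near a, f x = g x) -> {for a, continuous f} -> {for a, continuous g}.
Proof.
move=> fg cf; rewrite /prop_for /continuous_at -(nbhs_singleton fg).
by apply: cvg_trans cf; apply: near_eq_cvg; apply: filterS fg => x ->.
Qed.

Lemma row_entry_le (R : realType) n (y : 'rV[R]_n) i : `|y 0 i| <= `|y|.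
Proof.
rewrite [leRHS]/Num.Def.normr /= mx_normrE.
by apply: le_trans (le_bigmax _ _ (0, i)).
Qed.

Lemma row_norm_le (R : realType) n (y : 'rV[R]_n) (k : R) : 0 <= k ->
  (forall i, `|y 0 i| <= k) -> `|y| <= k.
Proof.
move=> k0 H; rewrite [leLHS]/Num.Def.normr /= mx_normrE.
by apply: bigmax_le => //= -[i j] _ /=; rewrite ord1.
Qed.

Lemma near0_segment (R : realType) (V : normedModType R) (P : V -> Prop) :
  (\forall y \near (0 : V), P y) ->
  \forall y \near (0 : V), forall c : R, 0 <= c <= 1 -> P (c *: y).
Proof.
move=> /nbhs_ballP[e /= e0 He]; apply/nbhs_ballP; exists e => //= y.
rewrite -ball_normE /= sub0r normrN => ye c /andP[c0 c1].
apply: He; rewrite -ball_normE /= sub0r normrN normrZ ger0_norm //.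
by apply: le_lt_trans ye; apply: ler_piMl.
Qed.

(** Landau's O at 0 with a bare constant of any sign, so that one constant can be chosen for each
    partial derivative and the constants summed. *)
Definition bigO_pow (R : realType) (V : normedModType R) k (f : V -> R) : Prop :=
  exists C : R, \forall y \near (0 : V), `|f y| <= C * `|y| ^+ k.

(** On the segment from 0 to [y] the mean value theorem bounds f(y) - f(0) by |y| times the partial
    derivatives at a point no farther from 0 than [y]; this gains one power of |y|. *)
Lemma bigO_pow_step (R : realType) n k (f : 'rV[R]_n -> R) :
  (\forall y \near (0 : 'rV[R]_n), differentiable f y) -> f 0 = 0 ->
  (forall i, bigO_pow k (pderive i f)) -> bigO_pow k.+1 f.
Proof.
move=> df f0 /choice[C HC].
exists (\sum_i `|C i|).
have HC' : \forall y \near (0 : 'rV[R]_n), forall i, `|pderive i f y| <= `|C i| * `|y| ^+ k.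
  apply: nbhs_forall => i; apply: filterS (HC i) => y h.
  by apply: le_trans h _; rewrite ler_wpM2r ?exprn_ge0 // ler_norm.
have := near0_segment (nbhsI df HC').
apply: filterS => y H.
have d c : 0 <= c <= 1 -> differentiable f (0 + c *: y).
  by move=> c01; rewrite add0r; have [] := H c c01.
have [c c01] := MVT_line d.
rewrite !add0r f0 subr0 => ->.
have [dc Hc] := H c c01.
rewrite derive_coord // mulr_suml; apply: le_trans (ler_norm_sum _ _ _) _.
apply: ler_sum => i _; rewrite normrZ.
apply: (@le_trans _ _ (`|y| * (`|C i| * `|y| ^+ k))).
  apply: ler_pM => //; first exact: row_entry_le.
  apply: le_trans (Hc i) _; rewrite ler_wpM2l //.
  case/andP: c01 => c0 c1.
  rewrite lerXn2r ?nnegrE // normrZ ger0_norm //; exact: ler_piMl.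
by rewrite exprS mulrCA.
Qed.

(** Continuous partial derivatives are bounded on a small ball, and a ball is convex, so the mean
    value theorem applies between any two of its points. *)
Lemma C1_lipschitz (R : realType) n (f : 'rV[R]_n -> R) (a : 'rV[R]_n) :
  (\forall y \near a, differentiable f y) ->
  (forall i, {for a, continuous (pderive i f)}) ->
  exists2 L : R, 0 <= L & exists2 r : R, 0 < r &
    forall y z, ball a r y -> ball a r z -> `|f y - f z| <= L * `|y - z|.
Proof.
move=> df cf.
have H : \forall y \near a, forall i, `|pderive i f y| <= `|pderive i f a| + 1.
  apply: nbhs_forall => i.
  have := near_dist_lt (cf i) ltr01; apply: filterS => y h.
  rewrite -[X in `|X|](subrK (pderive i f a)).
  apply: le_trans (ler_normD _ _) _.
  by rewrite addrC lerD2l distrC ltW.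
have /nbhs_ballP[r /= r0 Hr] := nbhsI df H.
exists (\sum_i (`|pderive i f a| + 1)); first by apply: sumr_ge0 => i _; rewrite addr_ge0.
exists r => // y z ay az.
have seg c : 0 <= c <= 1 -> ball a r (z + c *: (y - z)).
  move=> /andP[c0 c1]; move: ay az; rewrite -ball_normE /= => ay az.
  have -> : a - (z + c *: (y - z)) = (1 - c) *: (a - z) + c *: (a - y).
    apply/rowP => i; rewrite !mxE; ring.
  apply: le_lt_trans (ler_normD _ _) _; rewrite !normrZ !ger0_norm ?subr_ge0 //.
  (* The strict inequality below comes from the summand with factor [c], so c = 0 is treated
     apart. *)
  have [->|cn0] := eqVneq c 0; first by rewrite subr0 mul1r mul0r addr0.
  have cp : 0 < c by rewrite lt_neqAle eq_sym cn0.
  have -> : r = (1 - c) * r + c * r by ring.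
  apply: ler_ltD; last by rewrite ltr_pM2l.
  by rewrite ler_wpM2l ?subr_ge0 // ltW.
have d c : 0 <= c <= 1 -> differentiable f (z + c *: (y - z)).
  by move=> /seg /Hr[].
have [c c01] := MVT_line d.
rewrite [z + (y - z)]addrC subrK => ->.
have [dc Hc] := Hr _ (seg c c01).
rewrite derive_coord // mulr_suml; apply: le_trans (ler_norm_sum _ _ _) _.
apply: ler_sum => i _; rewrite normrZ mulrC.
by apply: ler_pM => //; [exact: Hc|exact: row_entry_le].
Qed.

(** * Uniqueness for second-order differential equations *)

Section ode.
Variables (R : realType) (n : nat).
Implicit Types (w u : R -> 'rV[R]_n) (s t : R).

(** The norm of a row is its largest entry, so the real mean value theorem is applied entry by
    entry, with an intermediate point that depends on the entry. *)
Lemma curve_MVT w s t (k : R) : 0 <= k -> w s = 0 ->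
  (forall c, 0 <= c <= 1 -> derivable w (s + c * (t - s)) 1 /\
     `|derive1 w (s + c * (t - s))| <= k) ->
  `|w t| <= k * `|t - s|.
Proof.
move=> k0 ws H; apply: row_norm_le => [|i]; first by rewrite mulr_ge0.
have d c : 0 <= c <= 1 -> differentiable (fun t => w t 0 i) (s + c *: (t - s)).
  move=> c01; apply/derivable1_diffP; have [+ _] := H c c01.
  by move=> /derivable_mxP /(_ 0 i).
have [c c01] := MVT_line d.
rewrite [s + (t - s)]addrC subrK ws mxE subr0 => ->.
have dc := d c c01.
have [dwc Hc] := H c c01.
rewrite (_ : 'D__ _ _ = (t - s) *: 'D_1 (fun t => w t 0 i) (s + c *: (t - s))); last first.
  by rewrite -derive_dirZ //; congr ('D__ _ _); rewrite [RHS]mulr1.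
rewrite -derive_row // normrZ mulrC ler_wpM2r //.
by apply: le_trans (row_entry_le _ _) _; rewrite -derive1E.
Qed.

Lemma ode2_zero w s (L : R) :
  (\forall t \near s, [/\ derivable w t 1, derivable (derive1 w) t 1 &
    `|derive1 (derive1 w) t| <= L * (`|w t| + `|derive1 w t|)]) ->
  w s = 0 -> derive1 w s = 0 -> \forall t \near s, w t = 0.
Proof.
move=> H ws w's.
have Hs := nbhs_singleton H.
have h20 : (0 : R) < 2^-1 by rewrite invr_gt0.
have cw (v : R -> 'rV[R]_n) : derivable v s 1 -> v s = 0 ->
    \forall t \near s, `|v t| < 2^-1.
  move=> /derivable1_diffP /differentiable_continuous cv vs.
  have := near_dist_lt cv h20.
  by apply: filterS => t; rewrite vs sub0r normrN.
have [dw dw' _] := Hs.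
have /nbhs_ballP[e /= e0 He] := nbhsI H (nbhsI (cw _ dw ws) (cw _ dw' w's)).
(* For |t - s| < d, a bound B on |w| + |w'| yields |w| <= B |t - s| and |w'| <= |L| B |t - s|, with
   sum at most d K B; hence the choice of [d] with d K <= 1/2. *)
pose K := 1 + `|L|.
have K0 : 0 < K by rewrite ltr_wpDr.
pose d := Num.min e (2^-1 / K).
have d0 : 0 < d by rewrite lt_min e0 divr_gt0 // invr_gt0.
have dK : d * K <= 2^-1.
  by rewrite -ler_pdivlMr // ge_min lexx orbT.
have sub t : `|t - s| < d -> ball s e t.
  by rewrite -ball_normE /= distrC => /lt_le_trans; apply; rewrite ge_min lexx.
(* By the mean value theorem, a bound on |w| + |w'| for |t - s| < d can be halved. *)
have main k : forall t, `|t - s| < d -> `|w t| + `|derive1 w t| <= 2^-1 ^+ k.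
  elim: k => [|k IH] t td.
    have [_ [h1 h2]] := He _ (sub t td).
    by rewrite expr0 (splitr 1) div1r ltW // ltrD.
  have seg c : 0 <= c <= 1 -> `|(s + c * (t - s)) - s| < d.
    move=> /andP[c0 c1]; rewrite addrAC subrr add0r normrM ger0_norm //.
    by apply: le_lt_trans td; apply: ler_piMl.
  have p0 : (0 : R) <= 2^-1 ^+ k by rewrite exprn_ge0 // invr_ge0.
  have B1 : `|w t| <= 2^-1 ^+ k * `|t - s|.
    apply: (curve_MVT p0 ws) => c c01; have [[dc _ _] _] := He _ (sub _ (seg c c01)).
    by split; [exact: dc|apply: le_trans (IH _ (seg c c01)); rewrite lerDr].
  have B2 : `|derive1 w t| <= `|L| * 2^-1 ^+ k * `|t - s|.
    have q0 : 0 <= `|L| * 2^-1 ^+ k by rewrite mulr_ge0.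
    apply: (curve_MVT q0 w's) => c c01; have [[_ dc h] _] := He _ (sub _ (seg c c01)).
    split; [exact: dc|apply: le_trans h _].
    apply: (@le_trans _ _ (`|L| * (`|w (s + c * (t - s))| + `|derive1 w (s + c * (t - s))|))).
      by rewrite ler_wpM2r ?addr_ge0 // ler_norm.
    by rewrite ler_wpM2l //; exact: IH (seg c c01).
  apply: le_trans (lerD B1 B2) _.
  rewrite (_ : _ + _ = (`|t - s| * K) * 2^-1 ^+ k); last by rewrite /K; ring.
  rewrite exprS ler_wpM2r //; apply: le_trans dK.
  by rewrite ler_wpM2r // ltW.
apply/nbhs_ballP; exists d => //= t; rewrite -ball_normE /= distrC => td.
apply/eqP; rewrite -normr_le0.
have cv : (fun k => (2^-1 : R) ^+ k) @ \oo --> (0 : R).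
  by apply: cvg_expr; rewrite ger0_norm ?invr_ge0 // invf_lt1 // ltr1n.
apply: (cvgr_to_ge cv); apply: nearW => k.
by apply: le_trans (main k t td); rewrite lerDl.
Qed.

(** The bounds on [f1] and [f2] themselves make the relation stable under products. It is applied
    with [N] the distance of two solutions in position and velocity, and with [f1], [f2] the
    right-hand sides of the geodesic equation along them. *)
Definition lip_pair s (N : R -> R) (f1 f2 : R -> R) : Prop :=
  exists2 L : R, 0 <= L &
    \forall t \near s, [/\ `|f1 t| <= L, `|f2 t| <= L & `|f1 t - f2 t| <= L * N t].

Lemma lip_pairM s N f1 f2 g1 g2 : (forall t, 0 <= N t) ->
  lip_pair s N f1 f2 -> lip_pair s N g1 g2 ->
  lip_pair s N (fun t => f1 t * g1 t) (fun t => f2 t * g2 t).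
Proof.
move=> N0 [L L0 Lf] [K K0 Kg].
exists (L * K + L * K); first by rewrite addr_ge0 // mulr_ge0.
have := nbhsI Lf Kg; apply: filterS => t [[f1L f2L fL] [g1K g2K gK]].
have LK0 : 0 <= L * K by rewrite mulr_ge0.
split.
- by apply: (@le_trans _ _ (L * K)); rewrite ?lerDl // normrM ler_pM.
- by apply: (@le_trans _ _ (L * K)); rewrite ?lerDl // normrM ler_pM.
rewrite (_ : _ - _ = f1 t * (g1 t - g2 t) + (f1 t - f2 t) * g2 t); last by ring.
apply: le_trans (ler_normD _ _) _; rewrite !normrM mulrDl; apply: lerD.
  by rewrite -mulrA ler_pM.
by rewrite mulrAC ler_pM // mulr_ge0.
Qed.

Lemma lip_pairD s N f1 f2 g1 g2 : 
  lip_pair s N f1 f2 -> lip_pair s N g1 g2 ->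
  lip_pair s N (fun t => f1 t + g1 t) (fun t => f2 t + g2 t).
Proof.
move=> [L L0 Lf] [K K0 Kg].
exists (L + K); first by rewrite addr_ge0.
have := nbhsI Lf Kg; apply: filterS => t [[f1L f2L fL] [g1K g2K gK]].
split.
- by apply: le_trans (ler_normD _ _) _; exact: lerD.
- by apply: le_trans (ler_normD _ _) _; exact: lerD.
rewrite opprD addrACA mulrDl.
by apply: le_trans (ler_normD _ _) _; exact: lerD.
Qed.

Lemma lip_pair_sum s N I (r : seq I) (f1 f2 : I -> R -> R) : (forall t, 0 <= N t) ->
  (forall i, lip_pair s N (f1 i) (f2 i)) ->
  lip_pair s N (fun t => \sum_(i <- r) f1 i t) (fun t => \sum_(i <- r) f2 i t).
Proof.
move=> N0 H; elim: r => [|i r IH].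
  exists 0; [by []|apply: (@filterE _ (nbhs s)) => t]; rewrite !big_nil subrr normr0 mul0r.
  by split.
have [L L0 HL] := lip_pairD (H i) IH; exists L; first exact: L0.
move: HL; apply: filterS => t /=; rewrite !big_cons; exact.
Qed.

Lemma lip_pair_coord s (N : R -> R) u1 u2 i : {for s, continuous u1} -> {for s, continuous u2} ->
  (forall t, `|u1 t - u2 t| <= N t) ->
  lip_pair s N (fun t => u1 t 0 i) (fun t => u2 t 0 i).
Proof.
move=> c1 c2 HN.
have B (u : R -> 'rV[R]_n) : {for s, continuous u} -> \forall t \near s, `|u t| <= `|u s| + 1.
  move=> cu; have := near_dist_lt cu ltr01; apply: filterS => t h.
  rewrite -[X in `|X|](subrK (u s)).
  apply: le_trans (ler_normD _ _) _.
  by rewrite addrC lerD2l distrC ltW.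
(* The summand 1 leaves room for the variation of [u1] and [u2] near [s], and makes the constant at
   least 1, so that it can also multiply [N t]. *)
exists (`|u1 s| + `|u2 s| + 1); first by rewrite !addr_ge0.
have := nbhsI (B _ c1) (B _ c2); apply: filterS => t [h1 h2]; split.
- apply: le_trans (row_entry_le _ _) _; apply: le_trans h1 _.
  by rewrite lerD2r lerDl.
- apply: le_trans (row_entry_le _ _) _; apply: le_trans h2 _.
  by rewrite lerD2r lerDr.
have N0 : 0 <= N t by apply: le_trans (HN t).
have -> : u1 t 0 i - u2 t 0 i = (u1 t - u2 t) 0 i by rewrite !mxE.
apply: le_trans (row_entry_le _ _) _; apply: le_trans (HN t) _.
by rewrite ler_peMl // lerDr addr_ge0.
Qed.

(** Both curves pass through the same point at time [s], so near [s] they stay in one ball on which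
    [f] is Lipschitz. *)
Lemma lip_pair_comp s (N : R -> R) u1 u2 (f : 'rV[R]_n -> R) :
  {for s, continuous u1} -> {for s, continuous u2} -> u1 s = u2 s ->
  (\forall y \near u1 s, differentiable f y) ->
  (forall i, {for u1 s, continuous (pderive i f)}) ->
  (forall t, `|u1 t - u2 t| <= N t) ->
  lip_pair s N (f \o u1) (f \o u2).
Proof.
move=> c1 c2 u12 df cf HN.
have [L L0 [r r0 Hr]] := C1_lipschitz df cf.
have b1 : \forall t \near s, ball (u1 s) r (u1 t) by exact: c1 (nbhsx_ballx _ _ r0).
have b2 : \forall t \near s, ball (u1 s) r (u2 t).
  by rewrite u12; exact: c2 (nbhsx_ballx _ _ r0).
have K0 : 0 <= `|f (u1 s)| + L * r by rewrite addr_ge0 // mulr_ge0 // ltW.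
have B y : ball (u1 s) r y -> `|f y| <= `|f (u1 s)| + L * r.
  move=> yr; rewrite -[X in `|X|](subrK (f (u1 s))) addrC.
  apply: le_trans (ler_normD _ _) _; rewrite lerD2l.
  apply: le_trans (Hr _ _ yr (ballxx _ r0)) _; rewrite ler_wpM2l //.
  by move: yr; rewrite -ball_normE /= distrC => /ltW.
exists (`|f (u1 s)| + L * r + L); first by rewrite addr_ge0.
have := nbhsI b1 b2; apply: filterS => t [h1 h2]; split.
- by apply: le_trans (B _ h1) _; rewrite lerDl.
- by apply: le_trans (B _ h2) _; rewrite lerDl.
apply: le_trans (Hr _ _ h1 h2) _.
apply: (@le_trans _ _ (L * N t)); first by rewrite ler_wpM2l.
by rewrite ler_wpM2r ?lerDr //; apply: le_trans (HN t).
Qed.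

(** The right-hand side is Lipschitz in position and velocity, so the difference [w] of the
    solutions satisfies |w''| <= L (|w| + |w'|) near [s], and [ode2_zero] applies. *)
Lemma geodesic_ode_unique (G : 'I_n -> 'I_n -> 'rV[R]_n -> 'rV[R]_n) u1 u2 s :
  (forall i j, \forall y \near u1 s, differentiable (G i j) y) ->
  (forall i j k, {for u1 s, continuous (pderive k (G i j))}) ->
  (forall u, u = u1 \/ u = u2 -> \forall t \near s,
     [/\ derivable u t 1, derivable (derive1 u) t 1 &
      derive1 (derive1 u) t =
        - \sum_i \sum_j (derive1 u t 0 i * derive1 u t 0 j) *: G i j (u t)]) ->
  u1 s = u2 s -> derive1 u1 s = derive1 u2 s ->
  \forall t \near s, u1 t = u2 t.
Proof.
move=> dG cG H us u's.
have H1 := H _ (or_introl erefl); have H2 := H _ (or_intror erefl).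
pose w := u1 - u2.
have W : \forall t \near s, derive1 w t = derive1 u1 t - derive1 u2 t.
  have := nbhsI H1 H2; apply: filterS => t [[d1 _ _] [d2 _ _]].
  by rewrite !derive1E (deriveB d1 d2).
have W' : \forall t \near s, derivable (derive1 w) t 1 /\
    derive1 (derive1 w) t = derive1 (derive1 u1) t - derive1 (derive1 u2) t.
  have := nbhsI (near_join W) (nbhsI H1 H2); apply: filterS => t [Wt [[_ d1 _] [_ d2 _]]].
  split.
    apply: (@near_eq_derivable _ _ _ (derive1 u1 - derive1 u2)); last exact: derivableB.
    by apply: filterS Wt => r ->.
  by rewrite !derive1E (near_eq_derive _ Wt) (deriveB d1 d2).
(* The difference of the derivatives stands for [derive1 w]: the two are known to agree only near
   [s], whereas the lemmas on [lip_pair] ask for a comparison with [N] at every time. *)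
pose N t := `|w t| + `|derive1 u1 t - derive1 u2 t|.
have N0 t : 0 <= N t by rewrite addr_ge0.
have [du1 du1' _] := nbhs_singleton H1; have [du2 du2' _] := nbhs_singleton H2.
have ct (u : R -> 'rV[R]_n) : derivable u s 1 -> {for s, continuous u}.
  by move=> /derivable1_diffP; exact: differentiable_continuous.
pose F u k t := \sum_i \sum_j (derive1 u t 0 i * derive1 u t 0 j) * G i j (u t) 0 k.
have LP k : lip_pair s N (F u1 k) (F u2 k).
  apply: lip_pair_sum => // i; apply: lip_pair_sum => // j.
  have HN t : `|derive1 u1 t - derive1 u2 t| <= N t by rewrite lerDr.
  have HN' t : `|u1 t - u2 t| <= N t by rewrite lerDl.
  have c1 := ct _ du1; have c2 := ct _ du2.
  have c1' := ct _ du1'; have c2' := ct _ du2'.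
  apply: (lip_pairM N0 (lip_pairM N0 (lip_pair_coord i c1' c2' HN) (lip_pair_coord j c1' c2' HN))).
  apply: (@lip_pair_comp s N u1 u2 (fun y => G i j y 0 k) c1 c2 us _ _ HN').
    by apply: filterS (dG i j) => y /differentiable_rowP.
  move=> l.
  have E : \forall y \near u1 s, pderive l (G i j) y 0 k = pderive l (fun y => G i j y 0 k) y.
    apply: filterS (dG i j) => y dy; exact: derive_rowd.
  apply: (near_eq_continuous E).
  have cc := @coord_continuous R 1 n 0 k (pderive l (G i j) (u1 s)).
  exact: (continuous_comp (cG i j l) cc).
have /choice[L HL] : forall k, exists L, 0 <= L /\
    \forall t \near s, `|F u1 k t - F u2 k t| <= L * N t.
  by move=> k; have [L L0 h] := LP k; exists L; split => //; move: h; apply: filterS => t [].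
suff : \forall t \near s, w t = 0 by apply: filterS => t /eqP; rewrite subr_eq0 => /eqP.
apply: (@ode2_zero w s (\sum_k L k)).
- have HL' := nbhs_forall (fun k => (HL k).2).
  have := nbhsI HL' (nbhsI (nbhsI W W') (nbhsI H1 H2)); apply: filterS.
  move=> t [hL [[Wt [dw' W't]] [[d1 d1' E1] [d2 d2' E2]]]].
  split; [exact: derivableB|exact: dw'|].
  rewrite W't E1 E2 opprK Wt -/(N t) mulr_suml.
  have S0 : 0 <= \sum_k (L k * N t) by apply: sumr_ge0 => k _; rewrite mulr_ge0 // (HL k).1.
  apply: row_norm_le => // k.
  apply: (@le_trans _ _ (L k * N t)); last first.
    rewrite (bigD1 k) //= lerDl; apply: sumr_ge0 => i _; by rewrite mulr_ge0 // (HL i).1.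
  have E u : (\sum_i \sum_j (derive1 u t 0 i * derive1 u t 0 j) *: G i j (u t)) 0 k
      = F u k t.
    rewrite summxE; apply: eq_bigr => i _; rewrite summxE; apply: eq_bigr => j _.
    by rewrite !mxE.
  by apply: le_trans (hL k); rewrite !mxE !E distrC addrC.
- by rewrite /w -[(u1 - u2) s]/(u1 s - u2 s) us subrr.
- by rewrite (nbhs_singleton W) u's subrr.
Qed.
End ode.

(** * Charts and components of vector fields *)

Section smooth_on_closure.
Variables (R : realType) (n : nat).
Implicit Types (O : set 'rV[R]_n).

Lemma smooth_on_differentiable (V : normedModType R) O (f : 'rV[R]_n -> V) :
  smooth_on O f -> forall x, O x -> differentiable f x.
Proof. by move=> sf x; exact: (sf [::] x). Qed.

Lemma smooth_on_pderive (V : normedModType R) O (f : 'rV[R]_n -> V) i :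
  smooth_on O f -> smooth_on O (pderive i f).
Proof. by move=> /smooth_onP sf; apply/smooth_onP => k; have [_ +] := sf k.+1; exact. Qed.

Lemma smooth_on_sub (V : normedModType R) O O' (f : 'rV[R]_n -> V) :
  O' `<=` O -> smooth_on O f -> smooth_on O' f.
Proof. by move=> OO sf s x /OO; exact: sf. Qed.

Lemma smooth_on_ext (V : normedModType R) O (f g : 'rV[R]_n -> V) : open O ->
  (forall x, O x -> f x = g x) -> smooth_on O f -> smooth_on O g.
Proof.
move=> oO fg /smooth_onP sf; apply/smooth_onP => k; exact: Ck_ext oO fg (sf k).
Qed.

Lemma smooth_on_cst (V : normedModType R) O (a : V) : smooth_on O (cst a).
Proof. by apply/smooth_onP => k; exact: Ck_cst. Qed.

Lemma smooth_onD (V : normedModType R) O (f g : 'rV[R]_n -> V) : open O ->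
  smooth_on O f -> smooth_on O g -> smooth_on O (fun y => f y + g y).
Proof.
by move=> oO /smooth_onP sf /smooth_onP sg; apply/smooth_onP => k; exact: CkD.
Qed.

Lemma smooth_onM O (f g : 'rV[R]_n -> R) : open O ->
  smooth_on O f -> smooth_on O g -> smooth_on O (fun y => f y * g y).
Proof.
by move=> oO /smooth_onP sf /smooth_onP sg; apply/smooth_onP => k; exact: CkM.
Qed.

Lemma smooth_on_sum (V : normedModType R) O I (r : seq I) (f : I -> 'rV[R]_n -> V) :
  open O -> (forall i, smooth_on O (f i)) ->
  smooth_on O (fun y => \sum_(i <- r) f i y).
Proof.
move=> oO sf; apply/smooth_onP => k; apply: Ck_sum => // i.
by have /smooth_onP := sf i.
Qed.

Lemma smooth_on_rowP m O (f : 'rV[R]_n -> 'rV[R]_m) : open O ->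
  smooth_on O f <-> forall i, smooth_on O (fun y => f y 0 i).
Proof.
move=> oO; split=> [/smooth_onP sf i|sf]; apply/smooth_onP => k.
  exact: ((Ck_rowP k f oO).1 (sf k)).
by apply/(Ck_rowP k f oO) => i; have /smooth_onP := sf i.
Qed.

Lemma smooth_on_comp m O (O' : set 'rV[R]_m) (f : 'rV[R]_m -> R)
    (phi : 'rV[R]_n -> 'rV[R]_m) : open O -> open O' ->
  (forall x, O x -> O' (phi x)) -> smooth_on O phi -> smooth_on O' f ->
  smooth_on O (f \o phi).
Proof.
move=> oO oO' OO /smooth_onP sp /smooth_onP sf; apply/smooth_onP => k.
exact: (Ck_comp oO oO' OO (sp k) (sf k)).
Qed.

Lemma smooth_on_continuous (V : normedModType R) O (f : 'rV[R]_n -> V) :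
  smooth_on O f -> forall x, O x -> {for x, continuous f}.
Proof. by move=> sf x Ox; apply: differentiable_continuous; exact: (sf [::] x Ox). Qed.

Lemma smooth_on_schwarz O (f : 'rV[R]_n -> R) i j y : open O -> smooth_on O f -> O y ->
  pderive i (pderive j f) y = pderive j (pderive i f) y.
Proof.
move=> oO sf Oy.
have si := smooth_on_pderive i sf; have sj := smooth_on_pderive j sf.
apply: (@schwarz R _ O f y (delta_mx 0 j) (delta_mx 0 i) oO Oy).
- exact: smooth_on_differentiable.
- exact: (smooth_on_differentiable sj).
- exact: (smooth_on_differentiable si).
- exact: (smooth_on_continuous (smooth_on_pderive i sj) Oy).
- exact: (smooth_on_continuous (smooth_on_pderive j si) Oy).
Qed.
End smooth_on_closure.

(** * Transition maps and change of components *)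

Section Charts.
Variables (R : realType) (n : nat) (M : smooth_manifold R n).
Implicit Types (c : chart R n M) (q : M) (O : set M).

Definition transition c c' : 'rV[R]_n -> 'rV[R]_n := c' \o cinv c.

Definition cimage c O := c @` (cdom c `&` O).

Lemma near_cdom c q : cdom c q -> \forall r \near q, cdom c r.
Proof. by move=> cq; apply: open_nbhs_nbhs; split => //; exact: cdom_open. Qed.

Lemma near_cinv c q (P : M -> Prop) : cdom c q -> (\forall r \near q, P r) ->
  \forall y \near c q, P (cinv c y).
Proof.
move=> cq Pq; have cc : {for c q, continuous (cinv c)}.
  by apply: cinv_continuous; exists q.
by apply: cc; rewrite /= cmapK.
Qed.

Lemma cdom_cinv c y : (c @` cdom c) y -> cdom c (cinv c y).
Proof. by move=> [q cq <-]; rewrite cmapK. Qed.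

Lemma cinvK c y : (c @` cdom c) y -> c (cinv c y) = y.
Proof. by move=> [q cq <-]; rewrite cmapK. Qed.

Lemma near_cimage c q : cdom c q -> \forall y \near c q, (c @` cdom c) y.
Proof. by move=> cq; apply: open_nbhs_nbhs; split; [exact: cimg_open|exists q]. Qed.

Lemma cimage_open c O : open O -> open (cimage c O).
Proof.
move=> oO; rewrite openE => _ [q [cq Oq] <-].
have h1 : \forall y \near c q, O (cinv c y).
  by apply: near_cinv => //; exact: open_nbhs_nbhs.
have := nbhsI h1 (near_cimage cq); apply: filterS => y [Oy [r cr E]].
by exists r => //; split => //; rewrite -E cmapK // in Oy.
Qed.

Lemma cimageP c O y : cimage c O y -> [/\ cdom c (cinv c y), O (cinv c y) & c (cinv c y) = y].
Proof. by move=> [q [cq Oq] <-]; rewrite cmapK. Qed.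

Lemma near_transition (T : Type) (f : M -> T) c c' q : cdom c q -> cdom c' q ->
  \forall y \near c q, f (cinv c' (transition c c' y)) = f (cinv c y).
Proof.
move=> cq c'q; have := near_cinv cq (near_cdom c'q).
by apply: filterS => y c'y; rewrite /transition /= cmapK.
Qed.

Lemma transition_smooth c c' : atlas c -> atlas c' ->
  smooth_on (cimage c (cdom c')) (transition c c').
Proof. exact: atlas_compatible. Qed.

Lemma transition_differentiable c c' q : atlas c -> atlas c' ->
  cdom c q -> cdom c' q -> differentiable (transition c c') (c q).
Proof.
move=> ac ac' cq c'q; apply: (smooth_on_differentiable (transition_smooth ac ac')).
by exists q.
Qed.

(** The chain rule, since near [c q] the expression of [f] in [c] is its expression in [c'] after
    the transition map. With [f] a chart it becomes the cocycle rule [transition_trans]; with [f]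
    real-valued it makes [vderive] independent of the chart. *)
Lemma chart_change_derive (V : normedModType R) (f : M -> V) c c' q v :
  atlas c -> atlas c' -> cdom c q -> cdom c' q ->
  differentiable (f \o cinv c') (c' q) ->
  'D_v (f \o cinv c) (c q) =
  'D_('D_v (transition c c') (c q)) (f \o cinv c') (c' q).
Proof.
move=> ac ac' cq c'q df.
have E : c' q = transition c c' (c q) by rewrite /transition /= cmapK.
rewrite -(near_eq_derive _ (near_transition f cq c'q)).
have := @derive_comp _ _ _ _ (transition c c') (f \o cinv c') (c q) v.
rewrite -E; apply => //; exact: transition_differentiable.
Qed.

Lemma transition_id c q v : cdom c q -> 'D_v (transition c c) (c q) = v.
Proof.
move=> cq; rewrite -[RHS](derive_id (c q) v); apply: near_eq_derive.
by have := near_cimage cq; apply: filterS => y; exact: cinvK.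
Qed.

Lemma chart_at_atlas q : atlas (chart_at q).
Proof. by rewrite /chart_at; case: cid => c []. Qed.

Lemma chart_at_cdom q : cdom (chart_at q) q.
Proof. by rewrite /chart_at; case: cid => c []. Qed.

Lemma componentsE c q u : atlas c -> cdom c q ->
  components c q u = 'D_u (transition (chart_at q) c) (chart_at q q).
Proof.
move=> ac cq; rewrite deriveE //.
by apply: transition_differentiable => //; [exact: chart_at_atlas|exact: chart_at_cdom].
Qed.

Lemma of_componentsE c q a : atlas c -> cdom c q ->
  of_components c q a = 'D_a (transition c (chart_at q)) (c q).
Proof.
move=> ac cq; rewrite deriveE //.
by apply: transition_differentiable => //; [exact: chart_at_atlas|exact: chart_at_cdom].
Qed.

Lemma transition_trans c c' c2 q v : atlas c -> atlas c' -> atlas c2 ->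
  cdom c q -> cdom c' q -> cdom c2 q ->
  'D_('D_v (transition c c') (c q)) (transition c' c2) (c' q) =
  'D_v (transition c c2) (c q).
Proof.
move=> ac ac' ac2 cq c'q c2q; have d := transition_differentiable ac' ac2 c'q c2q.
by rewrite -(chart_change_derive v ac ac' cq c'q d).
Qed.

Lemma components_of c c' q a : atlas c -> atlas c' -> cdom c q -> cdom c' q ->
  components c' q (of_components c q a) = 'D_a (transition c c') (c q).
Proof.
move=> ac ac' cq c'q; rewrite componentsE // of_componentsE //.
by rewrite transition_trans //; [exact: chart_at_atlas|exact: chart_at_cdom].
Qed.

Lemma of_componentsK c q a : atlas c -> cdom c q ->
  components c q (of_components c q a) = a.
Proof. by move=> ac cq; rewrite components_of // transition_id. Qed.

Lemma componentsK c q u : atlas c -> cdom c q ->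
  of_components c q (components c q u) = u.
Proof.
move=> ac cq; have ha := chart_at_atlas q; have hd := chart_at_cdom q.
by rewrite componentsE // of_componentsE // transition_trans // transition_id.
Qed.

Lemma components_change c c' q u : atlas c -> atlas c' -> cdom c q -> cdom c' q ->
  components c' q u = 'D_(components c q u) (transition c c') (c q).
Proof. by move=> ac ac' cq c'q; rewrite -components_of // componentsK. Qed.

Lemma components_chart_at q u : components (chart_at q) q u = u.
Proof.
have ha := chart_at_atlas q; have hd := chart_at_cdom q.
by rewrite componentsE // transition_id.
Qed.

Lemma componentsD c q u v : components c q (u + v) = components c q u + components c q v.
Proof. exact: linearD. Qed.

Lemma componentsZ c q k u : components c q (k *: u) = k *: components c q u.
Proof. exact: linearZ. Qed.

Lemma components_sum c q I (r : seq I) (u : I -> 'rV[R]_n) :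
  components c q (\sum_(i <- r) u i) = \sum_(i <- r) components c q (u i).
Proof. exact: linear_sum. Qed.

Lemma of_components_sum c q I (r : seq I) (u : I -> 'rV[R]_n) :
  of_components c q (\sum_(i <- r) u i) = \sum_(i <- r) of_components c q (u i).
Proof. exact: linear_sum. Qed.

Lemma of_componentsZ c q k u : of_components c q (k *: u) = k *: of_components c q u.
Proof. exact: linearZ. Qed.

Lemma of_components_coord c q a :
  of_components c q a = \sum_i a 0 i *: coord_field c i q.
Proof.
rewrite {1}(row_sum_delta a) of_components_sum; apply: eq_bigr => i _.
exact: of_componentsZ.
Qed.

Lemma vector_coord c q u : atlas c -> cdom c q ->
  u = \sum_i components c q u 0 i *: coord_field c i q.
Proof. by move=> ac cq; rewrite -of_components_coord componentsK. Qed.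

Lemma vderiveE (X : vector_field M) (f : M -> R) c q : atlas c -> cdom c q ->
  differentiable (f \o cinv c) (c q) ->
  vderive X f q = 'D_(components c q (X q)) (f \o cinv c) (c q).
Proof.
move=> ac cq df; rewrite componentsE // /vderive.
by apply: chart_change_derive => //; [exact: chart_at_atlas|exact: chart_at_cdom].
Qed.

(** Transition maps are smooth, so a single chart whose domain contains [O] decides smoothness in
    all charts. *)
Lemma smooth_function_chart c O (f : M -> R) : atlas c -> open O -> O `<=` cdom c ->
  smooth_on (cimage c O) (f \o cinv c) -> smooth_function O f.
Proof.
move=> ac oO Oc sf c' ac'.
have oi := @cimage_open c O oO; have oi' := @cimage_open c' O oO.
apply: (@smooth_on_ext _ _ _ _ ((f \o cinv c) \o transition c' c)) => //.
  by move=> _ [q [c'q /Oc cq] <-]; rewrite /transition /= (cmapK c'q) cmapK.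
apply: (smooth_on_comp oi' oi) => //.
  by move=> _ [q [c'q Oq] <-]; exists q; [split => //; exact: Oc|rewrite /transition /= cmapK].
apply: smooth_on_sub (transition_smooth ac' ac) => _ [q [c'q Oq] <-].
by exists q => //; split => //; exact: Oc.
Qed.

Definition field_rep c (X : vector_field M) : 'rV[R]_n -> 'rV[R]_n :=
  fun y => components c (cinv c y) (X (cinv c y)).

Lemma field_repE c X q : cdom c q -> field_rep c X (c q) = components c q (X q).
Proof. by move=> cq; rewrite /field_rep cmapK. Qed.

Lemma smooth_vector_field_chart c O X : atlas c -> open O -> O `<=` cdom c ->
  smooth_on (cimage c O) (field_rep c X) -> smooth_vector_field O X.
Proof.
move=> ac oO Oc sX c' ac'.
have oi := @cimage_open c O oO; have oi' := @cimage_open c' O oO.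
have Oi : cimage c' O `<=` cimage c' (cdom c).
  by move=> _ [q [c'q Oq] <-]; exists q => //; split => //; exact: Oc.
apply/(smooth_on_rowP _ oi') => k.
(* The k-th component of [X] in [c'] as a function of the coordinates of [c]: components in [c]
   times the Jacobian matrix of the transition. Composition with [transition c' c] then returns to
   the coordinates of [c']. *)
pose h z := \sum_i field_rep c X z 0 i * pderive i (transition c c') z 0 k.
have Oi' : cimage c (cdom c' `&` O) `<=` cimage c (cdom c').
  by move=> _ [q [cq [c'q Oq]] <-]; exists q.
have oi2 : open (cimage c (cdom c' `&` O)).
  by apply: cimage_open; apply: openI => //; exact: cdom_open.
have sh : smooth_on (cimage c (cdom c' `&` O)) h.
  apply: smooth_on_sum => // i; apply: smooth_onM => //.
    apply: ((smooth_on_rowP _ oi2).1 _ i); apply: smooth_on_sub sX.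
    by move=> _ [q [cq [c'q Oq]] <-]; exists q.
  apply: ((smooth_on_rowP _ oi2).1 _ k); apply: smooth_on_pderive.
  exact: smooth_on_sub Oi' (transition_smooth ac ac').
apply: (@smooth_on_ext _ _ _ _ (h \o transition c' c)) => //; last first.
  apply: (smooth_on_comp oi' oi2) => //.
    by move=> _ [q [c'q Oq] <-]; exists q; [split => //; exact: Oc|rewrite /transition /= cmapK].
  exact: smooth_on_sub Oi (transition_smooth ac' ac).
move=> _ [q [c'q Oq] <-]; have cq := Oc _ Oq.
rewrite /= /transition /= cmapK // /h field_repE // (components_change _ ac ac') //.
have dt := transition_differentiable ac ac' cq c'q.
rewrite (derive_coord _ dt) summxE; apply: eq_bigr => i _; by rewrite !mxE.
Qed.

Lemma const_field_rep c a q : atlas c -> cdom c q ->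
  components c q (const_field c a q) = a.
Proof. by move=> ac cq; rewrite /const_field of_componentsK. Qed.

Lemma const_field_smooth c a : atlas c -> smooth_vector_field (cdom c) (const_field c a).
Proof.
move=> ac; have oc := @cdom_open _ _ _ c.
apply: (smooth_vector_field_chart ac) => //.
apply: smooth_on_ext (@smooth_on_cst _ _ _ _ a); first exact: cimage_open.
by move=> y /cimageP[cy _ _]; rewrite /field_rep const_field_rep.
Qed.

Lemma smooth_vector_field_sub O O' X : open O' -> O' `<=` O ->
  smooth_vector_field O X -> smooth_vector_field O' X.
Proof.
move=> oO' OO sX c ac; apply: smooth_on_sub (sX c ac).
by move=> _ [q [cq Oq] <-]; exists q => //; split => //; exact: OO.
Qed.

Lemma smooth_vector_fieldD O (X Y : vector_field M) : open O ->
  smooth_vector_field O X -> smooth_vector_field O Y ->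
  smooth_vector_field O (fun q => X q + Y q).
Proof.
move=> oO sX sY c ac; have oi := @cimage_open c O oO.
have h := smooth_onD oi (sX c ac) (sY c ac).
by apply: smooth_on_ext h => // y _; rewrite -componentsD.
Qed.

Lemma smooth_vector_fieldZ O f (X : vector_field M) : open O ->
  smooth_function O f -> smooth_vector_field O X ->
  smooth_vector_field O (fun q => f q *: X q).
Proof.
move=> oO sf sX c ac; have oi := @cimage_open c O oO.
apply/(smooth_on_rowP _ oi) => k.
have h := smooth_onM oi (sf c ac) ((smooth_on_rowP _ oi).1 (sX c ac) k).
by apply: smooth_on_ext h => // y _; rewrite componentsZ !mxE.
Qed.

Lemma smooth_vector_field0 O : open O -> smooth_vector_field O (fun=> 0 : 'rV[R]_n).
Proof.
move=> oO c ac; apply: smooth_on_ext (@smooth_on_cst _ _ _ _ 0); first exact: cimage_open.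
by move=> y _; rewrite [RHS]linear0.
Qed.

Lemma smooth_vector_field_sum O I (r : seq I) (X : I -> vector_field M) : open O ->
  (forall i, smooth_vector_field O (X i)) ->
  smooth_vector_field O (fun q => \sum_(i <- r) X i q).
Proof.
move=> oO sX; elim: r => [|i r IH].
  have -> : (fun q => \sum_(i <- [::]) X i q) = (fun=> 0) by apply/funext => q; rewrite big_nil.
  exact: smooth_vector_field0.
have -> : (fun q => \sum_(j <- i :: r) X j q) = (fun q => X i q + \sum_(j <- r) X j q).
  by apply/funext => q; rewrite big_cons.
exact: smooth_vector_fieldD.
Qed.

Lemma smooth_component c O X i : atlas c -> open O -> O `<=` cdom c ->
  smooth_vector_field O X -> smooth_function O (fun q => components c q (X q) 0 i).
Proof.
move=> ac oO Oc sX; apply: (smooth_function_chart ac) => //.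
exact: ((smooth_on_rowP _ (@cimage_open c O oO)).1 (sX c ac) i).
Qed.

End Charts.

(** * Christoffel symbols *)

(** The torsion clause of [levi_civita] on its own: it makes sense without a metric, and the study
    of normal coordinates up to the curvature formula rests on it. *)
Definition symmetric_connection (R : realType) (n : nat) (M : smooth_manifold R n)
    (D : connection M) : Prop :=
  forall O X Y, open O ->
    smooth_vector_field O X -> smooth_vector_field O Y ->
    {in O, forall q, D X Y q - D Y X q = lie_bracket X Y q}.

Section Connections.
Variables (R : realType) (n : nat) (M : smooth_manifold R n) (D : connection M).
Implicit Types (c : chart R n M) (q : M) (O : set M) (X Y : vector_field M).

Lemma smooth_function_cst O (a : R) : @smooth_function R n M O (fun=> a).
Proof. by move=> c ac; exact: smooth_on_cst. Qed.

Lemma covd0l O Y q : open O -> smooth_vector_field O Y -> O q ->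
  D (fun=> 0) Y q = 0.
Proof.
move=> oO sY Oq; have s0 := smooth_vector_field0 oO.
(* Linearity on the left combines scaling and addition in one axiom; with the coefficient -1 and
   both fields 0 its right side cancels. *)
have E : D (fun=> -1 *: 0 + 0) Y q = -1 *: D (fun=> 0) Y q + D (fun=> 0) Y q :=
  @covd_linearl _ _ _ D O (fun=> -1) _ _ Y oO (@smooth_function_cst O (-1)) s0 s0 sY q (mem_set Oq).
by rewrite scaler0 addr0 scaleN1r addNr in E.
Qed.

Lemma covd0r O X q : open O -> smooth_vector_field O X -> O q ->
  D X (fun=> 0) q = 0.
Proof.
move=> oO sX Oq; have s0 := smooth_vector_field0 oO.
have := @covd_additiver _ _ _ D O X _ _ oO sX s0 s0 q (mem_set Oq).
have -> : (fun q : M => 0 + 0) = (fun=> 0 : 'rV[R]_n) by apply/funext => r; rewrite addr0.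
by move=> /eqP; rewrite -subr_eq subrr => /eqP <-.
Qed.

Lemma covd_suml O I (r : seq I) (f : I -> M -> R) (X : I -> vector_field M) Y q :
  open O -> (forall i, smooth_function O (f i)) ->
  (forall i, smooth_vector_field O (X i)) -> smooth_vector_field O Y -> O q ->
  D (fun q => \sum_(i <- r) f i q *: X i q) Y q =
  \sum_(i <- r) f i q *: D (X i) Y q.
Proof.
move=> oO sf sX sY Oq; elim: r => [|i r IH].
  rewrite big_nil -[RHS](covd0l oO sY Oq); congr (D _ Y q).
  by apply/funext => s; rewrite big_nil.
rewrite big_cons -IH.
have ss : smooth_vector_field O (fun q => \sum_(i <- r) f i q *: X i q).
  by apply: smooth_vector_field_sum => // j; exact: smooth_vector_fieldZ.
rewrite -(@covd_linearl _ _ _ D O (f i) _ _ Y oO (sf i) (sX i) ss sY q (mem_set Oq)).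
by congr (D _ Y q); apply/funext => s; rewrite big_cons.
Qed.

Lemma covd_sumr O I (r : seq I) (f : I -> M -> R) X (Y : I -> vector_field M) q :
  open O -> (forall i, smooth_function O (f i)) ->
  (forall i, smooth_vector_field O (Y i)) -> smooth_vector_field O X -> O q ->
  D X (fun q => \sum_(i <- r) f i q *: Y i q) q =
  \sum_(i <- r) (vderive X (f i) q *: Y i q + f i q *: D X (Y i) q).
Proof.
move=> oO sf sY sX Oq; elim: r => [|i r IH].
  rewrite big_nil -[RHS](covd0r oO sX Oq); congr (D X _ q).
  by apply/funext => s; rewrite big_nil.
rewrite big_cons -IH.
have si j : smooth_vector_field O (fun q => f j q *: Y j q) by exact: smooth_vector_fieldZ.
have ss : smooth_vector_field O (fun q => \sum_(i <- r) f i q *: Y i q).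
  exact: smooth_vector_field_sum.
rewrite -(@covd_leibniz _ _ _ D O (f i) _ _ oO (sf i) sX (sY i) q (mem_set Oq)).
rewrite -(@covd_additiver _ _ _ D O X _ _ oO sX (si i) ss q (mem_set Oq)).
by congr (D X _ q); apply/funext => s; rewrite big_cons.
Qed.

(** The row of the Christoffel symbols Gamma_ij^k, with k as the column index. *)
Definition christoffel c i j : 'rV[R]_n -> 'rV[R]_n :=
  field_rep c (D (coord_field c i) (coord_field c j)).

Definition christoffel_form c y (u v : 'rV[R]_n) : 'rV[R]_n :=
  \sum_i \sum_j (u 0 i * v 0 j) *: christoffel c i j y.

Lemma christoffel_smooth c i j : atlas c -> smooth_on (c @` cdom c) (christoffel c i j).
Proof.
move=> ac; have oc := @cdom_open _ _ _ c.
have := @covd_smooth _ _ _ D _ _ _ oc (const_field_smooth (delta_mx 0 i) ac)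
  (const_field_smooth (delta_mx 0 j) ac) c ac.
by rewrite setIid.
Qed.

Lemma smooth_vector_field_differentiable c O X q i : atlas c -> open O ->
  smooth_vector_field O X -> cdom c q -> O q ->
  differentiable (fun y => field_rep c X y 0 i) (c q).
Proof.
move=> ac oO sX cq Oq.
have /(_ i) si := (smooth_on_rowP _ (@cimage_open _ _ _ c O oO)).1 (sX c ac).
by apply: (smooth_on_differentiable si); exists q.
Qed.

(** Both fields are expanded in the coordinate fields; linearity over functions in [X] and the
    Leibniz rule in [Y] produce the two terms. *)
Lemma covd_coord c O X Y q : atlas c -> open O -> O `<=` cdom c ->
  smooth_vector_field O X -> smooth_vector_field O Y -> O q ->
  components c q (D X Y q) =
  'D_(components c q (X q)) (field_rep c Y) (c q)
  + christoffel_form c (c q) (components c q (X q)) (components c q (Y q)).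
Proof.
move=> ac oO Oc sX sY Oq; have cq := Oc _ Oq.
pose x i r := components c r (X r) 0 i.
pose y i r := components c r (Y r) 0 i.
have sx i : smooth_function O (x i) by exact: smooth_component.
have sy i : smooth_function O (y i) by exact: smooth_component.
have sc i : smooth_vector_field O (coord_field c i).
  by apply: smooth_vector_field_sub (const_field_smooth _ ac).
pose X' r := \sum_i x i r *: coord_field c i r.
pose Y' r := \sum_i y i r *: coord_field c i r.
have sX' : smooth_vector_field O X'.
  by apply: smooth_vector_field_sum => // i; exact: smooth_vector_fieldZ.
have sY' : smooth_vector_field O Y'.
  by apply: smooth_vector_field_sum => // i; exact: smooth_vector_fieldZ.
have XX : {in O, X =1 X'} by move=> r /set_mem /Oc cr; exact: vector_coord.
have YY : {in O, Y =1 Y'} by move=> r /set_mem /Oc cr; exact: vector_coord.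
(* The expansions agree with the fields on [O] only; locality of [D] allows the replacement. *)
rewrite (@covd_local _ _ _ D O X X' Y Y' oO sX sX' sY sY' XX YY q (mem_set Oq)).
rewrite (@covd_suml O _ _ x _ Y' q oO sx sc sY' Oq).
rewrite components_sum.
have dY : differentiable (field_rep c Y) (c q).
  apply/differentiable_rowP => i; exact: smooth_vector_field_differentiable sY cq Oq.
rewrite (derive_coord _ dY) /christoffel_form -big_split /=; apply: eq_bigr => i _.
rewrite componentsZ (@covd_sumr O _ _ y _ _ q oO sy sc (sc i) Oq).
rewrite -/(x i q).
under [in RHS]eq_bigr do rewrite -scalerA.
rewrite -scaler_sumr -scalerDr; congr (_ *: _).
rewrite components_sum [X in _ = X + _]row_sum_delta -big_split /=; apply: eq_bigr => j _.
rewrite componentsD !componentsZ const_field_rep // /christoffel field_repE //.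
congr (_ *: _ + _).
rewrite (@vderiveE _ _ _ _ _ c q ac cq); last exact: smooth_vector_field_differentiable sY cq Oq.
by rewrite const_field_rep // derive_rowd.
Qed.

Hypothesis Dtf : symmetric_connection D.

(** The bracket is defined through the coordinate functions of [chart_at q]. Read in [c], the
    coordinate fields act on these as partial derivatives, which commute. *)
Lemma lie_bracket_coord c i j q : atlas c -> cdom c q ->
  lie_bracket (coord_field c i) (coord_field c j) q = 0.
Proof.
move=> ac cq; apply/rowP => k; rewrite mxE [RHS]mxE.
set f := fun r : M => chart_at q r 0 k.
have aq := chart_at_atlas q; have dq := chart_at_cdom q.
pose W := cimage c (cdom (chart_at q)).
have oW : open W by apply: cimage_open; exact: cdom_open.
have Wq : W (c q) by exists q.
have sf : smooth_on W (f \o cinv c).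
  exact: ((smooth_on_rowP _ oW).1 (transition_smooth ac aq) k).
have V a b : vderive (coord_field c a) (vderive (coord_field c b) f) q =
     pderive a (pderive b (f \o cinv c)) (c q).
  have E y : W y -> (vderive (coord_field c b) f \o cinv c) y = pderive b (f \o cinv c) y.
    move=> Wy; have [cy _ yE] := cimageP Wy.
    rewrite /= (@vderiveE _ _ _ _ _ c _ ac cy).
      by rewrite const_field_rep // yE.
    by rewrite yE; exact: (smooth_on_differentiable sf Wy).
  have E' : \forall y \near c q,
      pderive b (f \o cinv c) y = (vderive (coord_field c b) f \o cinv c) y.
    by apply: filterS (open_nbhs_nbhs (conj oW Wq)) => y /E.
  rewrite (@vderiveE _ _ _ _ _ c q ac cq).
    rewrite (const_field_rep _ ac cq); exact: esym (near_eq_derive _ E').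
  apply: near_eq_differentiable E' _.
  exact: (smooth_on_differentiable (smooth_on_pderive b sf) Wq).
by rewrite !V (smooth_on_schwarz _ _ oW sf Wq) subrr.
Qed.

Lemma christoffel_sym c i j y : atlas c -> (c @` cdom c) y ->
  christoffel c i j y = christoffel c j i y.
Proof.
move=> ac /= cy; have cq := cdom_cinv cy; apply/eqP; rewrite -subr_eq0.
rewrite /christoffel /field_rep -[X in _ - X]scale1r -scaleNr -componentsZ -componentsD scaleN1r.
have oc := @cdom_open _ _ _ c.
rewrite (Dtf oc (const_field_smooth _ ac) (const_field_smooth _ ac) (mem_set cq)).
by rewrite lie_bracket_coord // [X in X == _]linear0.
Qed.

End Connections.

(** * Geodesics *)

Section Geodesics.
Variables (R : realType) (n : nat) (M : smooth_manifold R n) (D : connection M).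
Implicit Types (c : chart R n M) (q : M) (O : set M) (X Y : vector_field M).
Implicit Types (gam : R -> M) (s t : R).

Local Notation form := (christoffel_form D).

Lemma christoffel_form_linl c y a u v w :
  form c y (a *: u + v) w = a *: form c y u w + form c y v w.
Proof.
rewrite /christoffel_form scaler_sumr -big_split /=; apply: eq_bigr => i _.
rewrite scaler_sumr -big_split /=; apply: eq_bigr => j _.
by rewrite !mxE scalerA -scalerDl; congr (_ *: _); ring.
Qed.

Lemma christoffel_form_linr c y a u v w :
  form c y w (a *: u + v) = a *: form c y w u + form c y w v.
Proof.
rewrite /christoffel_form scaler_sumr -big_split /=; apply: eq_bigr => i _.
rewrite scaler_sumr -big_split /=; apply: eq_bigr => j _.
by rewrite !mxE scalerA -scalerDl; congr (_ *: _); ring.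
Qed.

Lemma christoffel_form0l c y w : form c y 0 w = 0.
Proof.
have /eqP := christoffel_form_linl c y 1 0 0 w.
by rewrite scaler0 addr0 scale1r -subr_eq subrr => /eqP <-.
Qed.

Lemma christoffel_form0r c y w : form c y w 0 = 0.
Proof.
have /eqP := christoffel_form_linr c y 1 0 0 w.
by rewrite scaler0 addr0 scale1r -subr_eq subrr => /eqP <-.
Qed.

Lemma christoffel_form_suml c y I (r : seq I) (a : I -> R) (X : I -> 'rV[R]_n) w :
  form c y (\sum_(i <- r) a i *: X i) w = \sum_(i <- r) a i *: form c y (X i) w.
Proof.
elim: r => [|i r IH]; first by rewrite !big_nil christoffel_form0l.
by rewrite !big_cons christoffel_form_linl IH.
Qed.

Lemma christoffel_form_sumr c y I (r : seq I) (a : I -> R) (X : I -> 'rV[R]_n) w :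
  form c y w (\sum_(i <- r) a i *: X i) = \sum_(i <- r) a i *: form c y w (X i).
Proof.
elim: r => [|i r IH]; first by rewrite !big_nil christoffel_form0r.
by rewrite !big_cons christoffel_form_linr IH.
Qed.

Lemma christoffel_formZ c y k u : form c y (k *: u) (k *: u) = (k ^+ 2) *: form c y u u.
Proof.
have := christoffel_form_linl c y k u 0; rewrite addr0 => ->.
have := christoffel_form_linr c y k u 0 u.
by rewrite addr0 christoffel_form0l addr0 => ->; rewrite christoffel_form0r addr0 scalerA.
Qed.

(** The transformation law of Christoffel symbols: the components in [c'] of the covariant
    derivative of one coordinate field of [c] along another are obtained from those in [c], and
    again from [covd_coord] in [c']. The second derivative of [phi] is the non-tensorial term. *)
Lemma christoffel_change c c' i j q : atlas c -> atlas c' -> cdom c q -> cdom c' q ->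
  let phi := transition c c' in
  'D_(christoffel D c i j (c q)) phi (c q) =
  pderive i (pderive j phi) (c q) + form c' (c' q) (pderive i phi (c q)) (pderive j phi (c q)).
Proof.
move=> ac ac' cq c'q phi.
pose O := cdom c `&` cdom c'.
have oO : open O by apply: openI; exact: cdom_open.
have Oc : O `<=` cdom c by move=> r [].
have Oc' : O `<=` cdom c' by move=> r [].
have Oq : O q by split.
have sc a : smooth_vector_field O (coord_field c a).
  by apply: smooth_vector_field_sub (const_field_smooth _ ac).
rewrite /christoffel field_repE // -components_change //.
rewrite (covd_coord D ac' oO Oc' (sc i) (sc j) Oq).
have E a r : O r -> components c' r (coord_field c a r) = pderive a phi (c r).
  by move=> [cr c'r]; rewrite /coord_field /const_field components_of.
rewrite (E i q Oq) (E j q Oq); congr (_ + _).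
have dphi : differentiable phi (c q) by exact: transition_differentiable.
have phiq : phi (c q) = c' q by rewrite /phi /transition /= cmapK.
have dY : differentiable (field_rep c' (coord_field c j)) (phi (c q)).
  rewrite phiq; apply/differentiable_rowP => k.
  exact: smooth_vector_field_differentiable (sc j) c'q Oq.
rewrite -phiq /pderive -(derive_comp _ dphi dY); apply: near_eq_derive.
have h1 := near_cinv cq (near_cdom c'q).
have := nbhsI h1 (near_cimage cq); apply: filterS => y [c'y cy].
have cy' := cdom_cinv cy.
rewrite /= /phi /transition /= field_repE // E //.
by rewrite cinvK.
Qed.

Lemma curve_change_derive c c' gam t : atlas c -> atlas c' ->
  {for t, continuous gam} -> cdom c (gam t) -> cdom c' (gam t) ->
  derivable (c \o gam) t 1 ->
  derive1 (c' \o gam) t = 'D_(derive1 (c \o gam) t) (transition c c') (c (gam t)).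
Proof.
move=> ac ac' ct ctt c'tt dg.
have E : \forall s \near t, (c' \o gam) s = (transition c c' \o (c \o gam)) s.
  have : \forall s \near t, cdom c (gam s) by exact: ct (near_cdom ctt).
  by apply: filterS => s cs; rewrite /transition /= cmapK.
rewrite derive1E (near_eq_derive _ E) derive_comp ?derive1E //.
  exact/derivable1_diffP.
exact: transition_differentiable.
Qed.

(** [covd_along] writes the equation at time t in [chart_at (gam t)], a chart that changes with t.
    Uniqueness requires one chart over an interval of times, hence the equation in every chart
    around [gam t]. *)
Definition geodesic_at gam t : Prop :=
  {for t, continuous gam} /\ forall c, atlas c -> cdom c (gam t) ->
    let u := c \o gam in
    [/\ derivable u t 1, derivable (derive1 u) t 1 &
     derive1 (derive1 u) t = - form c (u t) (derive1 u t) (derive1 u t)].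

Lemma derive_mul_row (f : R -> R) (h : R -> R) t :
  derivable f t 1 -> derivable h t 1 ->
  derivable (fun s => f s * h s) t 1 /\
  'D_1 (fun s => f s * h s) t = f t * 'D_1 h t + h t * 'D_1 f t.
Proof. by move=> df dh; split; [exact: derivableM df dh|exact: deriveM df dh]. Qed.

(** For u = phi(w) the chain rule gives u'' = dphi(w'') + d^2 phi(w', w'). The non-tensorial term of
    [christoffel_change] absorbs d^2 phi, so the equation passes from [c0] to [c]. *)
Lemma geodesic_geodesic_at (I : set R) gam t : open I -> geodesic D I gam -> I t ->
  geodesic_at gam t.
Proof.
move=> oI [sg geo] It; have [ct _] := sg t It; split => // c ac cg u.
have nI : \forall s \near t, I s by exact: open_nbhs_nbhs.
pose c0 := chart_at (gam t).
have a0 : atlas c0 by exact: chart_at_atlas.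
have c0g : cdom c0 (gam t) by exact: chart_at_cdom.
pose w := c0 \o gam.
have ncd c1 : cdom c1 (gam t) -> \forall s \near t, cdom c1 (gam s).
  by move=> h; exact: ct (near_cdom h).
have du c1 s : atlas c1 -> I s -> cdom c1 (gam s) -> derivable (c1 \o gam) s 1.
  by move=> a1 Is h; have [_ /(_ c1 a1 h 0%N)] := sg s Is.
have du' c1 s : atlas c1 -> I s -> cdom c1 (gam s) -> derivable (derive1 (c1 \o gam)) s 1.
  by move=> a1 Is h; have [_ /(_ c1 a1 h 1%N)] := sg s Is; rewrite derive1n1.
(* The velocity at [s] is recorded in [chart_at (gam s)]; in the fixed chart [c0] it becomes an
   ordinary derivative, which can be differentiated again. *)
have V s : I s -> cdom c0 (gam s) -> components c0 (gam s) (velocity gam s) = derive1 w s.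
  move=> Is cs; have [cts _] := sg s Is.
  have aa := chart_at_atlas (gam s); have dd := chart_at_cdom (gam s).
  rewrite componentsE // [RHS](@curve_change_derive (chart_at (gam s)) c0) //.
  exact: du.
have w'' : derive1 (derive1 w) t = - form c0 (w t) (derive1 w t) (derive1 w t).
  have := geo t It; rewrite /covd_along -/c0.
  have E : \forall s \near t, components c0 (gam s) (velocity gam s) = derive1 w s.
    by have := nbhsI nI (ncd c0 c0g); apply: filterS => s [Is cs]; exact: V.
  rewrite derive1E (near_eq_derive _ E) -derive1E => /eqP.
  rewrite addr_eq0 => /eqP ->; congr (- _).
  apply: eq_bigr => i _; apply: eq_bigr => j _; congr (_ *: _).
  by rewrite /christoffel field_repE // components_chart_at.
have dw := du c0 t a0 It c0g; have dw' := du' c0 t a0 It c0g.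
split; [exact: du|exact: du'|].
pose phi := transition c0 c.
pose W := cimage c0 (cdom c).
have oW : open W by apply: cimage_open; exact: cdom_open.
have sphi : smooth_on W phi by exact: transition_smooth.
have Wt : W (w t) by exists (gam t).
have dphi : differentiable phi (w t) by exact: transition_differentiable.
have u'E : \forall s \near t, derive1 u s = \sum_j derive1 w s 0 j *: pderive j phi (w s).
  have := nbhsI nI (nbhsI (ncd c0 c0g) (ncd c cg)); apply: filterS => s [Is [c0s cs]].
  have [cts _] := sg s Is.
  rewrite /u (curve_change_derive a0 ac cts c0s cs (du c0 s a0 Is c0s)).
  exact: derive_coord (transition_differentiable a0 ac c0s cs).
have u't := nbhs_singleton u'E.
have key : derive1 (derive1 u) t = 'D_(derive1 (derive1 w) t) phi (w t) +
   \sum_i \sum_j (derive1 w t 0 i * derive1 w t 0 j) *: pderive i (pderive j phi) (w t).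
  rewrite derive1E (near_eq_derive _ u'E).
  have dwj j : derivable (fun s => derive1 w s 0 j) t 1.
    by have /derivable_mxP := dw'; apply.
  have sh j k : smooth_on W (fun y => pderive j phi y 0 k).
    exact: ((smooth_on_rowP _ oW).1 (smooth_on_pderive j sphi) k).
  have dh j k := smooth_on_differentiable (sh j k) Wt.
  have dwt : differentiable w t := (derivable1_diffP w t).1 dw.
  have dhw j k : derivable ((fun y => pderive j phi y 0 k) \o w) t 1.
    apply/derivable1_diffP; exact: (differentiable_comp dwt (dh j k)).
  have P j k := derive_mul_row (dwj j) (dhw j k).
  have EE k : (fun s => (\sum_j derive1 w s 0 j *: pderive j phi (w s)) 0 k) =
      \sum_j (fun s => derive1 w s 0 j * ((fun y => pderive j phi y 0 k) \o w) s).
    apply/funext => s; rewrite summxE fct_sumE; apply: eq_bigr => j _; by rewrite mxE.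
  have dd : derivable (fun s => \sum_j derive1 w s 0 j *: pderive j phi (w s)) t 1.
    apply/derivable_mxP => i k; rewrite ord1 EE; apply: derivable_sum => j; exact: (P j k).1.
  apply/rowP => k; rewrite (derive_row _ dd) EE derive_sum; last by move=> j; exact: (P j k).1.
  under eq_bigr do rewrite (P _ k).2.
  rewrite big_split /= addrC mxE; congr (_ + _).
    rewrite [in RHS](derive_coord _ dphi) summxE; apply: eq_bigr => j _.
    by rewrite mxE mulrC derive1E (derive_row _ dw').
  rewrite exchange_big summxE; apply: eq_bigr => j _ /=; rewrite summxE.
  rewrite (derive_comp _ dwt (dh j k)) -derive1E (derive_coord _ (dh j k)) mulr_sumr.
  apply: eq_bigr => i _; rewrite mxE mulrA [derive1 w t 0 j * _]mulrC; congr (_ * _).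
  by rewrite -(derive_rowd _ _ (smooth_on_differentiable (smooth_on_pderive j sphi) Wt)).
(* Once both sides are expanded bilinearly in w', [christoffel_change] settles each pair of indices
   separately. *)
rewrite key w'' u't christoffel_form_suml [form c0 _ _ _]/christoffel_form -sumrN.
rewrite (derive_dir_sum dphi) -big_split -sumrN /=.
apply: eq_bigr => i _.
rewrite christoffel_form_sumr -sumrN (derive_dir_sum dphi) -big_split scaler_sumr -sumrN /=.
apply: eq_bigr => j _.
rewrite -scaleNr (derive_dirZ dphi) (christoffel_change _ _ a0 ac c0g cg).
rewrite scaleNr scalerDr opprD addrAC addNr add0r scalerA; congr (- (_ *: _)).
Qed.

End Geodesics.

Lemma derive1_scale (R : realType) (V : normedModType R) (u : R -> V) (k s : R) :
  derivable u (k * s) 1 ->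
  derivable (fun s => u (k * s)) s 1 /\ derive1 (fun s => u (k * s)) s = k *: derive1 u (k * s).
Proof.
move=> /derivable1_diffP du.
have dk : differentiable (fun s : R => k * s) s.
  apply/derivable1_diffP; exact: (@derivableM _ _ (cst k) id).
have Dk : 'D_1 (fun s : R => k * s) s = k.
  by rewrite deriveMl // derive_id [LHS]mulr1.
split; first by apply/derivable1_diffP; exact: (differentiable_comp dk du).
have := @derive_comp _ _ _ _ _ u s 1 dk du.
rewrite Dk derive1E => E; rewrite derive1E -(derive_dirZ du) -[RHS]/('D_(k * 1) u (k * s)) mulr1.
exact: E.
Qed.

(** * Uniqueness of geodesics on the manifold *)

Section GeodesicUniqueness.
Variables (R : realType) (n : nat) (M : smooth_manifold R n) (D : connection M).
Implicit Types (c : chart R n M) (q : M) (O : set M) (X Y : vector_field M).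
Implicit Types (gam : R -> M) (s t : R).

Local Notation geodesic_at := (@geodesic_at R n M D).

Lemma near_scale (k s : R) (P : R -> Prop) : (\forall t \near k * s, P t) ->
  \forall t \near s, P (k * t).
Proof. by move=> h; exact: (@mulrl_continuous _ k s) h. Qed.

(** Both sides of the equation are multiplied by k^2, the Christoffel form being quadratic in the
    velocity. The constant curve k = 0 is included and occurs in [normal_radial] at t = 0. *)
Lemma geodesic_at_scale gam k s : (\forall t \near k * s, geodesic_at gam t) ->
  geodesic_at (fun s => gam (k * s)) s.
Proof.
move=> H; have [cg Hs] := nbhs_singleton H; split.
  exact: (continuous_comp (@mulrl_continuous _ k s) cg).
move=> c ac cs u; have [du du' u''] := Hs c ac cs.
have [dv v'] := derive1_scale du.
have ncd : \forall t \near k * s, cdom c (gam t) by exact: cg (near_cdom cs).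
have E : \forall t \near s, derive1 u t = k *: derive1 (c \o gam) (k * t).
  have := near_scale (nbhsI ncd H); apply: filterS => t [ct [_ /(_ c ac ct)[dt _ _]]].
  exact: (derive1_scale dt).2.
have [dw w'] := derive1_scale du'.
have E' : \forall t \near s, k *: derive1 (c \o gam) (k * t) = derive1 u t.
  by move: E; apply: filterS => t; exact: esym.
have dkw : derivable (k *: (fun t => derive1 (c \o gam) (k * t))) s 1 by exact: derivableZ.
split; first exact: dv.
  exact: near_eq_derivable E' dkw.
rewrite derive1E (near_eq_derive _ E).
rewrite -[X in 'D__ X s]/(k *: (fun t => derive1 (c \o gam) (k * t))) (deriveZ _ dw).
have us : derive1 u s = k *: derive1 (c \o gam) (k * s) := v'.
by rewrite -derive1E w' u'' us christoffel_formZ scalerN scalerN scalerA -expr2.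
Qed.

Lemma velocity_components c gam t : atlas c -> cdom c (gam t) -> geodesic_at gam t ->
  components c (gam t) (velocity gam t) = derive1 (c \o gam) t.
Proof.
move=> ac cg [ct H].
have aa := chart_at_atlas (gam t); have dd := chart_at_cdom (gam t).
have [d1 _ _] := H _ aa dd.
by rewrite (componentsE _ ac cg) (curve_change_derive aa ac ct dd cg d1).
Qed.

(** The initial data of the equation. Velocities are rows of components in [chart_at] of the
    position, so their comparison is meaningful thanks to the first clause. *)
Definition agree gam1 gam2 t := gam1 t = gam2 t /\ velocity gam1 t = velocity gam2 t.

Lemma agree_chart c gam1 gam2 t : atlas c -> cdom c (gam1 t) ->
  geodesic_at gam1 t -> geodesic_at gam2 t ->
  gam1 t = gam2 t -> (velocity gam1 t = velocity gam2 t <->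
  derive1 (c \o gam1) t = derive1 (c \o gam2) t).
Proof.
move=> ac c1 g1 g2 E; have c2 : cdom c (gam2 t) by rewrite -E.
rewrite -(velocity_components ac c1 g1) -(velocity_components ac c2 g2) E.
split=> [->|]; first exact: erefl.
by move/(congr1 (of_components c (gam2 t))); rewrite !(componentsK _ ac c2).
Qed.

Lemma agree_near gam1 gam2 t : (\forall s \near t, gam1 s = gam2 s) -> agree gam1 gam2 t.
Proof.
move=> E; have Et := nbhs_singleton E; split; first exact: Et.
rewrite /velocity Et !derive1E; apply: near_eq_derive.
by move: E; apply: filterS => s /= ->.
Qed.

Lemma agree_open gam1 gam2 t :
  (\forall s \near t, geodesic_at gam1 s /\ geodesic_at gam2 s) ->
  agree gam1 gam2 t -> \forall s \near t, agree gam1 gam2 s.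
Proof.
move=> H [E V]; have [g1 g2] := nbhs_singleton H.
pose c := chart_at (gam1 t).
have ac : atlas c by exact: chart_at_atlas.
have c1 : cdom c (gam1 t) by exact: chart_at_cdom.
have c2 : cdom c (gam2 t) by rewrite -E.
have n1 : \forall s \near t, cdom c (gam1 s) by exact: g1.1 (near_cdom c1).
have n2 : \forall s \near t, cdom c (gam2 s) by exact: g2.1 (near_cdom c2).
have sG i j := christoffel_smooth D i j ac.
have oi := @cimg_open _ _ _ c.
have ic : (c @` cdom c) (c (gam1 t)) by exists (gam1 t).
have U : \forall s \near t, (c \o gam1) s = (c \o gam2) s.
  apply: (@geodesic_ode_unique R n (christoffel D c)).
  - move=> i j; have : \forall y \near c (gam1 t), (c @` cdom c) y by exact: near_cimage.
    by apply: filterS; exact: smooth_on_differentiable.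
  - move=> i j k; exact: (smooth_on_continuous (smooth_on_pderive k (sG i j)) ic).
  - move=> u [->|->].
      have := nbhsI H n1; apply: filterS => s [[[_ /(_ c ac) h] _] cs]; exact: (h cs).
    have := nbhsI H n2; apply: filterS => s [[_ [_ /(_ c ac) h]] cs]; exact: (h cs).
  - by rewrite /= E.
  - exact: ((agree_chart ac c1 g1 g2 E).1 V).
have GG : \forall s \near t, gam1 s = gam2 s.
  have := nbhsI U (nbhsI n1 n2); apply: filterS => s [us [cs1 cs2]].
  by rewrite -(cmapK cs1) -(cmapK cs2); congr (cinv c _).
(* Equality of velocities at [s] needs equality of positions around [s], hence [near_join]. *)
by have := near_join GG; apply: filterS => s; exact: agree_near.
Qed.

(** The Hausdorff property identifies the positions at [t]; only then can the velocities be
    compared, in a chart around the common point, where they are continuous. *)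
Lemma agree_closed gam1 gam2 t :
  (\forall s \near t, geodesic_at gam1 s /\ geodesic_at gam2 s) ->
  (forall P : set R, nbhs t P -> exists2 s, P s & agree gam1 gam2 s) ->
  agree gam1 gam2 t.
Proof.
move=> H clo; have [g1 g2] := nbhs_singleton H.
have E : gam1 t = gam2 t.
  apply: (hausdorff_carrier (s := M)) => A B nA nB.
  have nA' : \forall s \near t, A (gam1 s) by exact: g1.1 nA.
  have nB' : \forall s \near t, B (gam2 s) by exact: g2.1 nB.
  have [s [As Bs] [Es _]] := clo _ (nbhsI nA' nB').
  by exists (gam1 s); split => //; rewrite Es.
split; first exact: E.
pose c := chart_at (gam1 t).
have ac : atlas c by exact: chart_at_atlas.
have c1 : cdom c (gam1 t) by exact: chart_at_cdom.
have c2 : cdom c (gam2 t) by rewrite -E.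
have n1 : \forall s \near t, cdom c (gam1 s) by exact: g1.1 (near_cdom c1).
apply/(agree_chart ac c1 g1 g2 E).
have [_ d1 _] := g1.2 c ac c1; have [_ d2 _] := g2.2 c ac c2.
pose w := derive1 (c \o gam1) - derive1 (c \o gam2).
have cw : {for t, continuous w}.
  apply: differentiable_continuous; apply/derivable1_diffP; exact: derivableB.
apply/eqP; rewrite -subr_eq0 -normr_le0; apply/ler_addgt0Pl => e e0; rewrite addr0.
have [s [ws [[gs1 gs2] cs]] [Es Vs]] := clo _ (nbhsI (near_dist_lt cw e0) (nbhsI H n1)).
have w0 : w s = 0.
  have := (agree_chart ac cs gs1 gs2 Es).1 Vs.
  by rewrite /w -[(_ - _) s]/(derive1 (c \o gam1) s - derive1 (c \o gam2) s) => ->; rewrite subrr.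
by move: ws; rewrite w0 subr0 => /ltW.
Qed.

Lemma geodesic_unique gam1 gam2 :
  (forall t, 0 <= t <= 1 -> \forall s \near t, geodesic_at gam1 s /\ geodesic_at gam2 s) ->
  agree gam1 gam2 0 -> forall t, 0 <= t <= 1 -> gam1 t = gam2 t.
Proof.
move=> H A0.
pose I01 := `[0 : R, 1]%classic.
pose B := I01 `&` agree gam1 gam2.
have inI t : I01 t -> 0 <= t <= 1 by rewrite /I01 /= in_itv.
have BI : B = I01.
  apply: (@segment_connected R 0 1).
  - by exists 0; split => //; rewrite /I01 /= in_itv /= lexx ler01.
  - exists (interior (agree gam1 gam2)); first exact: open_interior.
    apply/seteqP; split => t [It At]; (split; first exact: It).
      exact: (agree_open (H _ (inI _ It)) At).
    exact: nbhs_singleton At.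
  - exists (closure B); first exact: closed_closure.
    apply/seteqP; split => t [It Bt]; (split; first exact: It); first exact: subset_closure.
    apply: (agree_closed (H _ (inI _ It))) => P nP.
    by have [s [[_ As] Ps]] := Bt P nP; exists s.
move=> t t01; have : I01 t by rewrite /I01 /= in_itv.
by rewrite -BI => -[_ []].
Qed.

End GeodesicUniqueness.

(** * Normal coordinates *)

(** It extends u' = y to time 0, where u(s) = s y is known on one side only and cannot be
    differentiated directly. *)
Lemma continuous_at0_eq (R : realType) (V : normedModType R) (f : R -> V) (y : V) :
  {for 0, continuous f} -> (forall t, 0 < t < 1 -> f t = y) -> f 0 = y.
Proof.
move=> cf H; apply/eqP; rewrite -subr_eq0 -normr_le0; apply/ler_addgt0Pl => e e0.
rewrite addr0; have /nbhs_ballP[d /= d0 Hd] := near_dist_lt cf e0.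
pose t := Num.min (d / 2) 2^-1.
have t0 : 0 < t by rewrite lt_min; apply/andP; rewrite divr_gt0 // invr_gt0.
have t1 : t < 1 by rewrite gt_min; apply/orP; right; rewrite invf_lt1 // ltr1n.
have td : t < d by rewrite gt_min; apply/orP; left; rewrite ltr_pdivrMr // ltr_pMr // ltr1n.
have := Hd t; rewrite -ball_normE /= sub0r normrN gtr0_norm // => /(_ td) /ltW.
have t01 : 0 < t < 1 by apply/andP.
by rewrite (H t t01).
Qed.

(** Inclusion-exclusion on T(a, a, a) over the sums of [u], [v], [w] isolates the sum of T over the
    six permutations; by symmetry in the first two arguments this is twice the cyclic sum. *)
Lemma cubic_polarization (R : realFieldType) (V : zmodType) (T : V -> V -> V -> R) u v w :
  (forall a b c d, T (a + b) c d = T a c d + T b c d) ->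
  (forall a b c d, T a (b + c) d = T a b d + T a c d) ->
  (forall a b c d, T a b (c + d) = T a b c + T a b d) ->
  (forall a b c, T a b c = T b a c) -> (forall a, T a a a = 0) ->
  T u v w + T v w u + T w u v = 0.
Proof.
move=> Tl Tm Tr Ts C.
have := C (u + v + w); have := C (u + v); have := C (u + w); have := C (v + w).
rewrite !(Tl, Tm, Tr) !C !(Ts v u) !(Ts w u) !(Ts w v); lra.
Qed.

Section NormalCoordinates.
Variables (R : realType) (n : nat) (M : smooth_manifold R n) (D : connection M).
Implicit Types (gam : R -> M) (s t : R) (y u v w : 'rV[R]_n).

Lemma is_exp_geodesic p v q : is_exp D p v q -> exists gam,
  [/\ forall t, 0 <= t <= 1 -> \forall s \near t, geodesic_at D gam s,
      gam 0 = p, velocity gam 0 = v & gam 1 = q].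
Proof.
move=> [a [b [gam [[a0 b1 geo] [g0 v0 g1]]]]]; exists gam; split => // t /andP[t0 t1].
have oI : open (`]a, b[%classic : set R) by exact: interval_open.
have : \forall s \near t, (`]a, b[%classic : set R) s.
  apply: open_nbhs_nbhs; split => //=; rewrite in_itv /=.
  by rewrite (lt_le_trans a0 t0) (le_lt_trans t1 b1).
by apply: filterS => s; exact: geodesic_geodesic_at oI geo.
Qed.

Lemma velocity_scale gam (t : R) : geodesic_at D gam 0 ->
  velocity (fun s => gam (t * s)) 0 = t *: velocity gam 0.
Proof.
move=> [_ H]; rewrite /velocity mulr0.
have [d _ _] := H _ (chart_at_atlas _) (chart_at_cdom _).
have d0 : derivable (chart_at (gam 0) \o gam) (t * 0) 1 by rewrite mulr0.
by have [_] := derive1_scale d0; rewrite mulr0.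
Qed.

Variables (p : M) (e : 'I_n -> 'rV[R]_n) (x : chart R n M).
Hypothesis hx : normal_coordinates D p e x.
Hypothesis Dtf : symmetric_connection D.

Let ax : atlas x. Proof. by case: hx. Qed.
Let xdom : cdom x p. Proof. by case: hx. Qed.
Let xp : x p = 0. Proof. by case: hx. Qed.

Lemma normal_image0 : (x @` cdom x) 0.
Proof. by exists p. Qed.

Lemma near_normal_image : \forall y \near (0 : 'rV[R]_n), (x @` cdom x) y.
Proof. by have := near_cimage xdom; rewrite xp. Qed.

(* For t in [0, 1], s |-> gam (t s) and the geodesic that defines exp_p at t y
   have the same initial data, hence agree at time 1. *)
Lemma normal_radial : \forall y \near (0 : 'rV[R]_n), exists gam,
  [/\ forall t, 0 <= t <= 1 -> \forall s \near t, geodesic_at D gam s,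
      gam 0 = p, velocity gam 0 = \sum_i (y : 'rV[R]_n) 0 i *: e i &
      forall t, 0 <= t <= 1 -> cdom x (gam t) /\ x (gam t) = t *: y].
Proof.
have := near0_segment near_normal_image; apply: filterS => y seg.
have ex t : 0 <= t <= 1 -> exists gam,
   [/\ forall s, 0 <= s <= 1 -> \forall r \near s, geodesic_at D gam r,
      gam 0 = p, velocity gam 0 = t *: \sum_i y 0 i *: e i & gam 1 = cinv x (t *: y)].
  move=> t01; have xy := seg t t01; have [_ _ _ /(_ _ (cdom_cinv xy))] := hx.
  rewrite cinvK // => /is_exp_geodesic[gam [h1 h2 h3 h4]]; exists gam; split => //.
  by rewrite h3 scaler_sumr; apply: eq_bigr => i _; rewrite mxE scalerA.
have i11 : (0 : R) <= (1 : R) <= 1 by apply/andP.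
have i00 : (0 : R) <= (0 : R) <= 1 by apply/andP.
have [gam [G1 G2 G3 G4]] := ex 1 i11.
exists gam; split => //; first by rewrite G3 scale1r.
move=> t t01; have xy := seg t t01.
suff -> : gam t = cinv x (t *: y) by split; [exact: cdom_cinv|exact: cinvK].
have [gam2 [K1 K2 K3 K4]] := ex t t01.
have : (fun s => gam (t * s)) 1 = gam2 1.
  apply: (@geodesic_unique _ _ _ D (fun s => gam (t * s)) gam2 _ _ 1 i11) => [s s01|].
    apply: nbhsI; last exact: K1.
    have ts01 : 0 <= t * s <= 1.
      case/andP: t01 => t0 t1; case/andP: s01 => s0 s1.
      by rewrite mulr_ge0 //= mulr_ile1.
    have := near_scale (near_join (G1 _ ts01)).
    by apply: filterS => r; exact: geodesic_at_scale.
  split; first by rewrite mulr0 G2 K2.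
  by rewrite velocity_scale ?G3 ?K3 ?scale1r //; exact: nbhs_singleton (G1 0 i00).
by rewrite mulr1 K4.
Qed.

(** The first clause compares two expressions of the velocity at time 0. In the second, [t] stays in
    the open interval because differentiating at [t] requires x(gam s) = s y on both sides of
    [t]. *)
Lemma normal_radial_eq : \forall y \near (0 : 'rV[R]_n),
  of_components x p y = \sum_i (y : 'rV[R]_n) 0 i *: e i /\
  forall t, 0 < t < 1 -> christoffel_form D x (t *: y) y y = 0.
Proof.
have := normal_radial; apply: filterS => y [gam [H g0 v0 Hx]].
pose u := x \o gam.
have i00 : (0 : R) <= (0 : R) <= 1 by apply/andP.
have g_at0 := nbhs_singleton (H 0 i00).
have uE t : 0 < t < 1 -> \forall s \near t, u s = s *: y.
  move=> t01; have oI : open (`]0, 1[%classic : set R) by exact: interval_open.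
  have : \forall s \near t, (`]0, 1[%classic : set R) s.
    by apply: open_nbhs_nbhs; split => //=; rewrite in_itv.
  apply: filterS => s /=; rewrite in_itv /= => /andP[s0 s1].
  have s01 : 0 <= s <= 1 by rewrite !ltW.
  exact: (Hx s s01).2.
have u'E t : 0 < t < 1 -> derive1 u t = y.
  move=> t01; rewrite derive1E (near_eq_derive _ (uE t t01)).
  have := @is_derive_line _ _ (0 : 'rV[R]_n) y t => -[_].
  by have -> : (fun s : R => 0 + s *: y) = (fun s : R => s *: y) by apply/funext => s; rewrite add0r.
have d0 : cdom x (gam 0) by rewrite g0.
have [_ du' _] := g_at0.2 x ax d0.
have u'0 : derive1 u 0 = y.
  apply: continuous_at0_eq u'E; apply: differentiable_continuous.
  exact/derivable1_diffP.
split.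
  have := velocity_components ax d0 g_at0; rewrite u'0 v0 g0 => E.
  by rewrite -[in LHS]E componentsK.
move=> t t01; have t01' : 0 <= t <= 1 by case/andP: t01 => ? ?; rewrite !ltW.
have [dt xt] := Hx t t01'.
have [_ /(_ x ax dt)[_ _]] := nbhs_singleton (H t t01').
rewrite -/u u'E // -[u t]/(x (gam t)) xt.
have E : \forall s \near t, derive1 u s = cst y s.
  have oI : open (`]0, 1[%classic : set R) by exact: interval_open.
  have : \forall s \near t, (`]0, 1[%classic : set R) s.
    by apply: open_nbhs_nbhs; split => //=; rewrite in_itv.
  by apply: filterS => s /=; rewrite in_itv /= => /u'E.
rewrite derive1E (near_eq_derive _ E) derive_cst => /esym/eqP.
by rewrite oppr_eq0 => /eqP.
Qed.

Lemma normal_frame y : of_components x p y = \sum_i y 0 i *: e i.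
Proof.
have /nbhs_ballP[d /= d0 Hd] := normal_radial_eq.
(* The norm of [k *: y] is below d / 2, so the relation known near 0 applies to it; homogeneity then
   gives it for every [y]. *)
pose k := d / (2 * (`|y| + 1)).
have y0 : 0 < `|y| + 1 by rewrite ltr_wpDl.
have k0 : 0 < k by rewrite divr_gt0 // mulr_gt0.
have kb : ball 0 d (k *: y).
  rewrite -ball_normE /= sub0r normrN normrZ gtr0_norm // /k mulrAC ltr_pdivrMr ?mulr_gt0 //.
  rewrite ltr_pM2l //; apply: (@lt_le_trans _ _ (`|y| + 1)); first by rewrite ltrDl.
  by rewrite ler_peMl ?ler1n // ltW.
have [E _] := Hd _ kb.
apply: (@scalerI _ _ k); first by rewrite gt_eqF.
rewrite -of_componentsZ E scaler_sumr; apply: eq_bigr => i _; by rewrite mxE scalerA.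
Qed.

Lemma normal_coord_field i : coord_field x i p = e i.
Proof.
rewrite /coord_field /const_field normal_frame (bigD1 i) //= mxE !eqxx scale1r.
by rewrite big1 ?addr0 // => j /negPf ji; rewrite mxE ji andbF scale0r.
Qed.

Definition form_along u v : 'rV[R]_n -> 'rV[R]_n := fun z => christoffel_form D x z u v.

Lemma form_along_differentiable u v z : (x @` cdom x) z -> differentiable (form_along u v) z.
Proof.
move=> xz; apply/differentiable_rowP => k.
have -> : (fun z => form_along u v z 0 k) =
   \sum_i (fun z => \sum_j (u 0 i * v 0 j) * christoffel D x i j z 0 k).
  apply/funext => s; rewrite fct_sumE summxE; apply: eq_bigr => i _.
  by rewrite summxE; apply: eq_bigr => j _; rewrite mxE.
apply: differentiable_sum => i.
have -> : (fun z => \sum_j (u 0 i * v 0 j) * christoffel D x i j z 0 k) =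
   \sum_j ((u 0 i * v 0 j) *: (fun z => christoffel D x i j z 0 k)).
  by apply/funext => s; rewrite fct_sumE.
apply: differentiable_sum => j; apply: differentiableZ.
have := smooth_on_differentiable (christoffel_smooth D i j ax) xz.
by move/differentiable_rowP; apply.
Qed.

Lemma form_along_diag : \forall y \near (0 : 'rV[R]_n), form_along y y y = 0.
Proof.
have /nbhs_ballP[d /= d0 Hd] := normal_radial_eq.
apply/nbhs_ballP; exists (d / 2) => /=; first by rewrite divr_gt0.
move=> y; rewrite -ball_normE /= sub0r normrN => yd.
(* The radial equation stops short of t = 1, so [y] is reached as the midpoint of the ray to 2 y;
   this costs a factor 2 in the radius and a factor 4 in the form. *)
have y2 : ball 0 d (2 *: y).
  by rewrite -ball_normE /= sub0r normrN normrZ ger0_norm // mulrC -ltr_pdivlMr.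
have [_ /(_ 2^-1)] := Hd _ y2.
have h : (0 : R) < (2^-1 : R) < 1 by rewrite invr_gt0 ltr0n invf_lt1 // ltr1n.
move=> /(_ h); rewrite scalerA mulVf ?pnatr_eq0 // scale1r christoffel_formZ => /eqP.
by rewrite scaler_eq0 expf_eq0 pnatr_eq0 /= => /eqP.
Qed.

(* Gamma_y(y, y) = 0 at y = s a reads s^2 Gamma_(s a)(a, a) = 0; at s = 0 one
   concludes by continuity. *)
Lemma form_along_ray a : \forall s \near (0 : R), form_along a a (s *: a) = 0.
Proof.
have h : \forall s \near (0 : R), form_along (s *: a) (s *: a) (s *: a) = 0.
  have c : {for 0, continuous (fun s : R => s *: a)} by exact: scalel_continuous.
  have h0 : \forall v \near ((0 : R) *: a), form_along v v v = 0.
    by rewrite scale0r; exact: form_along_diag.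
  exact: c h0.
have h' : \forall s \near (0 : R), s != 0 -> form_along a a (s *: a) = 0.
  move: h; apply: filterS => s; rewrite /form_along christoffel_formZ => /eqP.
  by rewrite scaler_eq0 expf_eq0 /= => /orP[->//|/eqP].
have df : {for 0, continuous (fun s : R => form_along a a (s *: a))}.
  apply: continuous_comp; first exact: scalel_continuous.
  rewrite scale0r; apply: differentiable_continuous.
  exact: form_along_differentiable normal_image0.
have E0 : form_along a a ((0 : R) *: a) = 0.
  apply/eqP; rewrite -normr_le0; apply/ler_addgt0Pl => eps eps0; rewrite addr0.
  have /nbhs_ballP[d /= d0 Hd] := nbhsI (near_dist_lt df eps0) h'.
  have := Hd (d / 2); rewrite -ball_normE /= sub0r normrN gtr0_norm ?divr_gt0 //.
  rewrite ltr_pdivrMr // ltr_pMr // ltr1n => /(_ isT)[+ H2].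
  by rewrite H2 ?subr0 ?gt_eqF ?divr_gt0 // => /ltW.
move: h'; apply: filterS => s H; have [->|/H//] := eqVneq s 0; exact: E0.
Qed.

Lemma form_along_sym u v z : (x @` cdom x) z -> form_along u v z = form_along v u z.
Proof.
move=> xz; rewrite /form_along /christoffel_form exchange_big /=.
apply: eq_bigr => i _; apply: eq_bigr => j _.
by rewrite (christoffel_sym Dtf i j ax xz) mulrC.
Qed.

(** Polarization: a symmetric bilinear map that vanishes on the diagonal is 0. *)
Lemma form_along0 u v : form_along u v 0 = 0.
Proof.
have diag a : form_along a a 0 = 0.
  by have := nbhs_singleton (form_along_ray a); rewrite scale0r.
have := diag (1 *: u + v); rewrite /form_along christoffel_form_linl !christoffel_form_linr.
rewrite -!/(form_along _ _ 0) !diag !scale1r add0r addr0.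
rewrite (form_along_sym v u normal_image0) -mulr2n => /eqP.
by rewrite -scaler_nat scaler_eq0 pnatr_eq0 /= => /eqP.
Qed.

Definition form_derive u v w : 'rV[R]_n := 'D_w (form_along u v) 0.

(** A derivative along the ray s |-> s a, on which Gamma(a, a) is 0 near the origin by
    [form_along_ray]. *)
Lemma form_derive_diag a : form_derive a a a = 0.
Proof.
have d := form_along_differentiable a a normal_image0.
have dl : differentiable (fun s : R => s *: a) 0 by exact: differentiableZl.
have Dl : 'D_1 (fun s : R => s *: a) 0 = a.
  have := @is_derive_line _ _ (0 : 'rV[R]_n) a 0 => -[_].
  by have -> : (fun s : R => 0 + s *: a) = (fun s : R => s *: a) by apply/funext => s; rewrite add0r.
have d0 : differentiable (form_along a a) ((fun s : R => s *: a) 0) by rewrite /= scale0r.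
have := @derive_comp R R _ _ (fun s : R => s *: a) (form_along a a) 0 1 dl d0.
rewrite Dl /= scale0r -/(form_derive a a a) => <-.
have E : \forall s \near (0 : R), (form_along a a \o (fun s : R => s *: a)) s = cst 0 s.
  exact: form_along_ray.
by rewrite (near_eq_derive _ E) derive_cst.
Qed.

Lemma form_deriveDl u u' v w : form_derive (u + u') v w = form_derive u v w + form_derive u' v w.
Proof.
have d1 := form_along_differentiable u v normal_image0.
have d2 := form_along_differentiable u' v normal_image0.
rewrite /form_derive -deriveD; [|exact: diff_derivable|exact: diff_derivable].
congr ('D_w _ 0); apply/funext => z; rewrite -[u]scale1r /form_along christoffel_form_linl.
by rewrite !scale1r.
Qed.

Lemma form_derive_sym u v w : form_derive u v w = form_derive v u w.
Proof.
apply: near_eq_derive; have := near_normal_image; apply: filterS => z.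
exact: form_along_sym.
Qed.

Lemma form_deriveDm u v v' w : form_derive u (v + v') w = form_derive u v w + form_derive u v' w.
Proof. by rewrite form_derive_sym form_deriveDl !(form_derive_sym u). Qed.

Lemma form_deriveDr u v w w' : form_derive u v (w + w') = form_derive u v w + form_derive u v w'.
Proof. by rewrite /form_derive derive_dirD //; exact: form_along_differentiable normal_image0. Qed.

Lemma form_derive_cyclic u v w k :
  form_derive u v w 0 k + form_derive v w u 0 k + form_derive w u v 0 k = 0.
Proof.
apply: (cubic_polarization (T := fun u v w => form_derive u v w 0 k)) => [a b c d|a b c d|a b c d|a b c|a].
- by rewrite form_deriveDl mxE.
- by rewrite form_deriveDm mxE.
- by rewrite form_deriveDr mxE.
- by rewrite form_derive_sym.
- by rewrite form_derive_diag mxE.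
Qed.

End NormalCoordinates.

(** * Taylor expansion *)

Section Taylor.
Variables (R : realType) (n : nat).
Implicit Types (f : 'rV[R]_n -> R) (U : set 'rV[R]_n).

Lemma bigO_pow0 (V : normedModType R) (f : V -> R) : {for 0, continuous f} -> bigO_pow 0%N f.
Proof.
move=> cf; exists (`|f 0| + 1).
have := near_dist_lt cf ltr01; apply: filterS => y h.
rewrite expr0 mulr1 -[X in `|X|](subrK (f 0)).
apply: le_trans (ler_normD _ _) _.
by rewrite addrC lerD2l distrC ltW.
Qed.

(** Third derivatives are bounded near 0 by continuity; [bigO_pow_step] climbs back from them three
    times and uses one vanishing hypothesis each time. *)
Lemma bigO_pow3 U f : open U -> U 0 -> smooth_on U f -> f 0 = 0 ->
  (forall a, pderive a f 0 = 0) -> (forall a b, pderive b (pderive a f) 0 = 0) ->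
  bigO_pow 3%N f.
Proof.
move=> oU U0 sf f0 f1 f2.
have nd (h : 'rV[R]_n -> R) : smooth_on U h -> \forall y \near (0 : 'rV[R]_n), differentiable h y.
  move=> sh; have : \forall y \near (0 : 'rV[R]_n), U y by exact: open_nbhs_nbhs.
  by apply: filterS; exact: smooth_on_differentiable.
have s1 a := smooth_on_pderive a sf.
have s2 a b := smooth_on_pderive b (s1 a).
apply: (bigO_pow_step (nd _ sf) f0) => a.
apply: (bigO_pow_step (nd _ (s1 a)) (f1 a)) => b.
apply: (bigO_pow_step (nd _ (s2 a b)) (f2 a b)) => c.
exact: (bigO_pow0 (smooth_on_continuous (smooth_on_pderive c (s2 a b)) U0)).
Qed.

Lemma derive_coordinate (y v : 'rV[R]_n) i : 'D_v (fun y : 'rV[R]_n => y 0 i) y = v 0 i.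
Proof.
have d : differentiable (id : 'rV[R]_n -> 'rV[R]_n) y by exact: ex_diff.
by rewrite -(derive_rowd v i d) derive_id.
Qed.

Lemma smooth_on_coordinate U i : open U -> smooth_on U (fun y : 'rV[R]_n => y 0 i).
Proof.
move=> oU; apply/smooth_onP => -[|k].
  by split=> // x _; exact: differentiable_coord.
split=> [x _|j]; first exact: differentiable_coord.
apply: (Ck_ext oU _ (@Ck_cst R n R k U ((delta_mx 0 j : 'rV[R]_n) 0 i))) => x _.
by rewrite /pderive derive_coordinate.
Qed.

(** [C] is not assumed symmetric, so the Hessian of the quadratic form is C a b + C b a and no
    factor 1/2 appears. This suits the coefficients - R_ihjk / 3, which in general are not symmetric
    in h and k. *)
Lemma taylor2 U f c (C : 'I_n -> 'I_n -> R) : open U -> U 0 -> smooth_on U f ->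
  f 0 = c -> (forall a, pderive a f 0 = 0) ->
  (forall a b, pderive b (pderive a f) 0 = C a b + C b a) ->
  bigO_pow 3%N (fun y => f y - (c + \sum_h \sum_k C h k * (y 0 h * y 0 k))).
Proof.
move=> oU U0 sf f0 f1 f2.
pose q (y : 'rV[R]_n) := \sum_h \sum_k C h k * (y 0 h * y 0 k).
pose d a h : R := (delta_mx 0 a : 'rV[R]_n) 0 h.
pose q1 a (y : 'rV[R]_n) := \sum_h \sum_k C h k * (y 0 h * d a k + y 0 k * d a h).
have sx i := smooth_on_coordinate i oU.
have scst (r : R) : smooth_on U (fun _ : 'rV[R]_n => r) by exact: smooth_on_cst.
have smon h k : smooth_on U (fun y : 'rV[R]_n => C h k * (y 0 h * y 0 k)).
  apply: smooth_onM (scst _) _ => //; exact: smooth_onM.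
have sq : smooth_on U q.
  by apply: smooth_on_sum => // h; exact: smooth_on_sum.
have dx i y : differentiable (fun y : 'rV[R]_n => y 0 i) y by exact: differentiable_coord.
have Dx i y a : pderive a (fun y : 'rV[R]_n => y 0 i) y = d a i.
  by rewrite /pderive derive_coordinate.
have dmon i j y : differentiable (fun y : 'rV[R]_n => y 0 i * y 0 j) y.
  exact: differentiableM (dx i y) (dx j y).
have Dsum2 (F : 'I_n -> 'I_n -> 'rV[R]_n -> R) y a :
    (forall h k, differentiable (F h k) y) ->
    pderive a (fun y => \sum_h \sum_k C h k * F h k y) y =
    \sum_h \sum_k C h k * pderive a (F h k) y.
  move=> dF; rewrite /pderive.
  have -> : (fun y => \sum_h \sum_k C h k * F h k y) =
     \sum_h \sum_k (C h k *: F h k).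
    apply/funext => z; rewrite fct_sumE; apply: eq_bigr => h _.
    by rewrite fct_sumE; apply: eq_bigr => k _.
  have dZ h k : derivable (C h k *: F h k) y (delta_mx 0 a).
    by apply: derivableZ; exact: diff_derivable.
  rewrite derive_sum; last by move=> h; exact: derivable_sum.
  apply: eq_bigr => h _; rewrite derive_sum; last by move=> k; exact: dZ.
  by apply: eq_bigr => k _; rewrite (deriveZ _ (diff_derivable (dF h k))).
have Dq a y : pderive a q y = q1 a y.
  rewrite /q Dsum2; last by move=> h k; exact: dmon.
  apply: eq_bigr => h _; apply: eq_bigr => k _; congr (_ * _).
  have := deriveM (diff_derivable (v := delta_mx 0 a) (dx h y)) (diff_derivable (dx k y)).
  by rewrite !derive_coordinate.
have Dq1 a b : pderive b (q1 a) 0 = C a b + C b a.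
  have dl i (r : R) y : differentiable (fun y : 'rV[R]_n => y 0 i * r) y.
    exact: differentiableM (dx i y) (differentiable_cst r y).
  have Dl i (r : R) y : pderive b (fun y : 'rV[R]_n => y 0 i * r) y = d b i * r.
    have := deriveM (diff_derivable (v := delta_mx 0 b) (dx i y)) (derivable_cst r y (delta_mx 0 b)).
    rewrite derive_coordinate derive_cst scaler0 add0r => E.
    exact: etrans E (mulrC _ _).
  rewrite /q1 Dsum2; last by move=> h k; exact: differentiableD (dl _ _ _) (dl _ _ _).
  have E h k : pderive b (fun y : 'rV[R]_n => y 0 h * d a k + y 0 k * d a h) 0 =
      d b h * d a k + d b k * d a h.
    rewrite -!(Dl _ _ 0); apply: deriveD; exact: diff_derivable (dl _ _ _).
  under eq_bigr do under eq_bigr do rewrite E mulrDr.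
  under eq_bigr do rewrite big_split /=.
  have dE a' h : d a' h = (h == a')%:R by rewrite /d mxE eqxx.
  rewrite big_split /= addrC; congr (_ + _).
    rewrite (bigD1 a) //= [X in _ + X]big1 ?addr0 => [|h ha]; last first.
      by rewrite big1 // => k _; rewrite !dE (negPf ha) mulr0 mulr0.
    rewrite (bigD1 b) //= big1 ?addr0 => [|k kb]; last by rewrite !dE (negPf kb) mul0r mulr0.
    by rewrite !dE !eqxx mulr1 mulr1.
  rewrite (bigD1 b) //= [X in _ + X]big1 ?addr0 => [|h hb]; last first.
    by rewrite big1 // => k _; rewrite !dE (negPf hb) mul0r mulr0.
  rewrite (bigD1 a) //= big1 ?addr0 => [|k ka]; last by rewrite !dE (negPf ka) mulr0 mulr0.
  by rewrite !dE !eqxx mulr1 mulr1.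
(* The subtraction is written with a factor -1 so that the closure of smoothness under sums and
   products applies. *)
pose F y := f y + (- 1) * (c + q y).
have sF : smooth_on U F.
  apply: smooth_onD => //; apply: smooth_onM => //; exact: smooth_onD.
have q0 : q 0 = 0.
  by apply: big1 => h _; apply: big1 => k _; rewrite mxE mul0r mulr0.
have q10 a : q1 a 0 = 0.
  by apply: big1 => h _; apply: big1 => k _; rewrite !mxE !mul0r addr0 mulr0.
have DF (h w : 'rV[R]_n -> R) (r : R) a y : differentiable h y -> differentiable w y ->
    pderive a (fun y => h y + (- 1) * (r + w y)) y = pderive a h y - pderive a w y.
  move=> dh dw.
  have -> : (fun y => h y + -1 * (r + w y)) = (h - (cst r + w)).
    by apply/funext => z; rewrite mulN1r.
  have drw := derivableD (derivable_cst r y (delta_mx 0 a)) (diff_derivable dw).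
  rewrite /pderive (deriveB (diff_derivable dh) drw).
  by rewrite (deriveD (derivable_cst r y (delta_mx 0 a)) (diff_derivable dw)) derive_cst add0r.
have DFU a y : U y -> pderive a F y = pderive a f y + -1 * (0 + q1 a y).
  move=> Uy; rewrite (DF _ _ _ _ _ (smooth_on_differentiable sf Uy) (smooth_on_differentiable sq Uy)).
  by rewrite Dq add0r mulN1r.
have -> : (fun y => f y - (c + \sum_h \sum_k C h k * (y 0 h * y 0 k))) = F.
  by apply/funext => y; rewrite /F mulN1r.
apply: (bigO_pow3 oU U0 sF).
- by rewrite /F f0 q0 addr0 mulN1r subrr.
- by move=> a; rewrite DFU // f1 q10 addr0 mulr0 addr0.
move=> a b; rewrite (pderive_ext b oU (DFU a) U0).
have sq1 : smooth_on U (q1 a).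
  by apply: smooth_on_ext (smooth_on_pderive a sq) => // y _; rewrite Dq.
rewrite (DF _ _ _ _ _ (smooth_on_differentiable (smooth_on_pderive a sf) U0)
  (smooth_on_differentiable sq1 U0)).
by rewrite f2 Dq1 subrr.
Qed.
End Taylor.

(** * Product rule for a scalar function times a row *)

Section ProductRule.
Variables (R : realType) (n : nat) (V : normedModType R).

Lemma derive_scale (A : V -> R) (B : V -> 'rV[R]_n) y u :
  differentiable A y -> differentiable B y ->
  derivable (fun z => A z *: B z) y u /\
  'D_u (fun z => A z *: B z) y = A y *: 'D_u B y + 'D_u A y *: B y.
Proof.
move=> dA dB.
have dBk k := (differentiable_rowP B y).1 dB k.
have dAu := diff_derivable (v := u) dA.
have dBu k := diff_derivable (v := u) (dBk k).
have d : derivable (fun z => A z *: B z) y u.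
  apply/derivable_mxP => i k; rewrite ord1.
  have -> : (fun z => (A z *: B z) 0 k) = A * (fun z => B z 0 k).
    by apply/funext => z; rewrite mxE.
  exact: derivableM dAu (dBu k).
split => //; apply/rowP => k; rewrite derive_row //.
have -> : (fun z => (A z *: B z) 0 k) = A * (fun z => B z 0 k).
  by apply/funext => z; rewrite mxE.
rewrite (deriveM dAu (dBu k)) !mxE (derive_rowd u k dB); congr (_ + _).
by rewrite [LHS]mulrC.
Qed.

Lemma derive_sum_scale m (A : 'I_m -> V -> R) (B : 'I_m -> V -> 'rV[R]_n) y u :
  (forall i, differentiable (A i) y) -> (forall i, differentiable (B i) y) ->
  derivable (fun z => \sum_i A i z *: B i z) y u /\
  'D_u (fun z => \sum_i A i z *: B i z) y =
  \sum_i (A i y *: 'D_u (B i) y + 'D_u (A i) y *: B i y).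
Proof.
move=> dA dB.
have -> : (fun z => \sum_i A i z *: B i z) = \sum_i (fun z => A i z *: B i z).
  by apply/funext => z; rewrite fct_sumE.
have d i := derive_scale u (dA i) (dB i).
split; first by apply: derivable_sum => i; exact: (d i).1.
rewrite derive_sum => [|i]; last exact: (d i).1.
by apply: eq_bigr => i _; rewrite (d i).2.
Qed.
End ProductRule.

Lemma smooth_vector_field_ext (R : realType) n (M : smooth_manifold R n) (O : set M)
    (X Y : vector_field M) : open O -> {in O, X =1 Y} ->
  smooth_vector_field O X -> smooth_vector_field O Y.
Proof.
move=> oO XY sX c ac; apply: smooth_on_ext (sX c ac); first exact: cimage_open.
by move=> y /cimageP[_ Oy _]; rewrite XY // inE.
Qed.

Lemma componentsB (R : realType) n (M : smooth_manifold R n) (c : chart R n M) (q : M) u v :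
  components c q (u - v) = components c q u - components c q v.
Proof. exact: linearB. Qed.

(** * Curvature and metric at the origin *)

Section Curvature.
Variables (R : realType) (n : nat) (M : smooth_manifold R n) (D : connection M).
Variables (p : M) (e : 'I_n -> 'rV[R]_n) (x : chart R n M).
Hypothesis hx : normal_coordinates D p e x.
Hypothesis Dtf : symmetric_connection D.
Implicit Types (X Y Z : vector_field M) (u v w y : 'rV[R]_n).

Let ax : atlas x. Proof. by case: hx. Qed.
Let xdom : cdom x p. Proof. by case: hx. Qed.
Let xp : x p = 0. Proof. by case: hx. Qed.

Local Notation dform := (form_derive D x).

Lemma form_along_delta a b z :
  form_along D x (delta_mx 0 a) (delta_mx 0 b) z = christoffel D x a b z.
Proof.
rewrite /form_along /christoffel_form (bigD1 a) //= [X in _ + X]big1 ?addr0 => [|i ia]; last first.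
  by rewrite big1 // => j _; rewrite !mxE (negPf ia) mul0r scale0r.
rewrite (bigD1 b) //= big1 ?addr0 => [|j jb]; last by rewrite !mxE (negPf jb) andbF mulr0 scale0r.
by rewrite !mxE !eqxx mulr1 scale1r.
Qed.

Lemma christoffel0 a b : christoffel D x a b 0 = 0.
Proof. by rewrite -form_along_delta (form_along0 hx Dtf). Qed.

Lemma christoffel_differentiable0 a b : differentiable (christoffel D x a b) 0.
Proof.
exact: (smooth_on_differentiable (christoffel_smooth D a b ax) (normal_image0 hx)).
Qed.

Lemma form_derive_delta a b w :
  dform (delta_mx 0 a) (delta_mx 0 b) w = 'D_w (christoffel D x a b) 0.
Proof.
by congr ('D_w _ 0); apply/funext => z; exact: form_along_delta.
Qed.

Lemma form_derive_coord u v w :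
  dform u v w = \sum_i \sum_j (u 0 i * v 0 j) *: 'D_w (christoffel D x i j) 0.
Proof.
have dc i j := christoffel_differentiable0 i j.
have dZ i j : derivable ((u 0 i * v 0 j) *: christoffel D x i j) 0 w.
  by apply: derivableZ; exact: diff_derivable (dc i j).
have E : form_along D x u v = \sum_i \sum_j ((u 0 i * v 0 j) *: christoffel D x i j).
  apply/funext => z; rewrite fct_sumE; apply: eq_bigr => i _.
  by rewrite fct_sumE; apply: eq_bigr => j _.
rewrite /form_derive E derive_sum; last by move=> i; exact: derivable_sum.
apply: eq_bigr => i _; rewrite derive_sum; last by move=> j; exact: dZ.
by apply: eq_bigr => j _; rewrite (deriveZ _ (diff_derivable (dc i j))).
Qed.

Section Fields.
Variable O : set M.
Hypotheses (oO : open O) (Ox : O `<=` cdom x) (Op : O p).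

Let W := cimage x O.
Let oW : open W. Proof. exact: cimage_open. Qed.
Let W0 : W 0. Proof. by exists p. Qed.

Lemma field_rep_smooth X : smooth_vector_field O X -> smooth_on W (field_rep x X).
Proof. by move=> sX; exact: sX. Qed.

Lemma covd_rep X Y : smooth_vector_field O X -> smooth_vector_field O Y ->
  forall z, W z -> field_rep x (D X Y) z =
    \sum_a field_rep x X z 0 a *: pderive a (field_rep x Y) z +
    \sum_a \sum_b (field_rep x X z 0 a * field_rep x Y z 0 b) *: christoffel D x a b z.
Proof.
move=> sX sY z Wz; have [xz Oz zE] := cimageP Wz.
rewrite {1}/field_rep (covd_coord D ax oO Ox sX sY Oz) zE; congr (_ + _).
exact: derive_coord (smooth_on_differentiable (field_rep_smooth sY) Wz).
Qed.

Lemma covd_rep0 X Y : smooth_vector_field O X -> smooth_vector_field O Y ->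
  components x p (D X Y p) = 'D_(components x p (X p)) (field_rep x Y) 0.
Proof.
move=> sX sY; rewrite (covd_coord D ax oO Ox sX sY Op) xp.
by rewrite -/(form_along D x _ _ 0) (form_along0 hx Dtf) addr0.
Qed.

(** Gamma vanishes at the origin, so the outer covariant derivative is a directional derivative, and
    in the product rule only the terms in which Gamma itself is differentiated survive. *)
Lemma covd2_rep0 X Y Z : smooth_vector_field O X -> smooth_vector_field O Y ->
  smooth_vector_field O Z ->
  let u := components x p (X p) in let v := components x p (Y p) in
  components x p (D X (D Y Z) p) =
    'D_('D_u (field_rep x Y) 0) (field_rep x Z) 0 +
    \sum_a \sum_b (v 0 a * u 0 b) *: pderive b (pderive a (field_rep x Z)) 0 +
    dform v (components x p (Z p)) u.
Proof.
move=> sX sY sZ u v.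
have sYr := field_rep_smooth sY; have sZr := field_rep_smooth sZ.
have sDYZ : smooth_vector_field O (D Y Z) by exact: covd_smooth.
rewrite covd_rep0 // -/u.
have E : \forall z \near (0 : 'rV[R]_n), field_rep x (D Y Z) z =
    \sum_a field_rep x Y z 0 a *: pderive a (field_rep x Z) z +
    \sum_a \sum_b (field_rep x Y z 0 a * field_rep x Z z 0 b) *: christoffel D x a b z.
  by apply: filterS (open_nbhs_nbhs (conj oW W0)) => z; exact: covd_rep.
rewrite (near_eq_derive _ E).
have dYa a : differentiable (fun z => field_rep x Y z 0 a) 0.
  exact: ((differentiable_rowP _ _).1 (smooth_on_differentiable sYr W0)).
have dZa a : differentiable (fun z => field_rep x Z z 0 a) 0.
  exact: ((differentiable_rowP _ _).1 (smooth_on_differentiable sZr W0)).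
have dpZ a := smooth_on_differentiable (smooth_on_pderive a sZr) W0.
have dc a b := christoffel_differentiable0 a b.
have dYZ a b : differentiable (fun z => field_rep x Y z 0 a * field_rep x Z z 0 b) 0.
  exact: differentiableM (dYa a) (dZa b).
have [d1 D1] := derive_sum_scale u dYa dpZ.
have d2 a := derive_sum_scale u (dYZ a) (dc a).
pose K a z := \sum_b (field_rep x Y z 0 a * field_rep x Z z 0 b) *: christoffel D x a b z.
have E2 : (fun z => \sum_a K a z) = \sum_a K a.
  by apply/funext => z; rewrite fct_sumE.
have d3 : derivable (fun z => \sum_a K a z) 0 u.
  by rewrite E2; apply: derivable_sum => a; exact: (d2 a).1.
rewrite (deriveD d1 d3) D1 E2 derive_sum => [|a]; last exact: (d2 a).1.
have r0 T : field_rep x T 0 = components x p (T p) by rewrite -xp field_repE.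
congr (_ + _).
  rewrite big_split /= addrC; congr (_ + _).
    rewrite (derive_coord _ (smooth_on_differentiable sZr W0)); apply: eq_bigr => a _.
    by rewrite (derive_rowd u a (smooth_on_differentiable sYr W0)).
  apply: eq_bigr => a _; rewrite (derive_coord _ (dpZ a)) scaler_sumr.
  by apply: eq_bigr => b _; rewrite scalerA r0.
rewrite form_derive_coord; apply: eq_bigr => a _; rewrite (d2 a).2.
by apply: eq_bigr => b _; rewrite christoffel0 scaler0 addr0 !r0.
Qed.

(** The first derivatives of Z cancel against the bracket term, as [X, Y] = D_X Y - D_Y X, and the
    second derivatives cancel by symmetry. Only the values of the fields at [p] remain, which is the
    tensoriality of the curvature. *)
Lemma curvature_rep0 X Y Z : smooth_vector_field O X -> smooth_vector_field O Y ->
  smooth_vector_field O Z ->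
  let u := components x p (X p) in let v := components x p (Y p) in
  let w := components x p (Z p) in
  components x p (curvature_operator D X Y Z p) = dform u w v - dform v w u.
Proof.
move=> sX sY sZ u v w.
have sDXY : smooth_vector_field O (D X Y) by exact: covd_smooth.
have sDYX : smooth_vector_field O (D Y X) by exact: covd_smooth.
have LE q : O q -> lie_bracket X Y q = D X Y q - D Y X q.
  by move=> Oq; rewrite -(Dtf oO sX sY) ?inE.
(* Absence of torsion expresses the bracket through covariant derivatives, and these are smooth by
   the axioms on [D]. *)
have sL : smooth_vector_field O (lie_bracket X Y).
  have s2 := smooth_vector_fieldZ oO (@smooth_function_cst _ _ _ O (-1)) sDYX.
  apply: smooth_vector_field_ext (smooth_vector_fieldD oO sDXY s2) => // q /set_mem Oq.
  by rewrite LE // scaleN1r.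
have sZr := field_rep_smooth sZ.
have dZ := smooth_on_differentiable sZr W0.
rewrite /curvature_operator componentsD componentsB.
rewrite (covd2_rep0 sX sY sZ) (covd2_rep0 sY sX sZ) covd_rep0 // LE //.
rewrite componentsB !covd_rep0 // -/u -/v -/w.
rewrite -[- 'D_v _ 0]scaleN1r (derive_dirD dZ) (derive_dirZ dZ) scaleN1r.
have s1 c := smooth_on_pderive c sZr.
have dk c := smooth_on_differentiable (s1 c) W0.
have P c d k : pderive c (pderive d (field_rep x Z)) 0 0 k =
    pderive c (pderive d (fun z => field_rep x Z z 0 k)) 0.
  rewrite /pderive (derive_rowd _ k (dk d)); apply: near_eq_derive.
  apply: filterS (open_nbhs_nbhs (conj oW W0)) => z Wz.
  exact: derive_rowd (smooth_on_differentiable sZr Wz).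
have H a b : pderive a (pderive b (field_rep x Z)) 0 = pderive b (pderive a (field_rep x Z)) 0.
  apply/rowP => k; apply: etrans (P a b k) _; apply: etrans _ (esym (P b a k)).
  exact: smooth_on_schwarz oW ((smooth_on_rowP _ oW).1 sZr k) W0.
have -> : \sum_a \sum_b (v 0 a * u 0 b) *: pderive b (pderive a (field_rep x Z)) 0 =
   \sum_a \sum_b (u 0 a * v 0 b) *: pderive b (pderive a (field_rep x Z)) 0.
  rewrite exchange_big /=; apply: eq_bigr => a _; apply: eq_bigr => b _.
  by rewrite H [v 0 b * _]mulrC.
have cancel (A B S T1 T2 : 'rV[R]_n) : A - B - (A + S + T1) + (B + S + T2) = T2 - T1.
  by apply/rowP => k; rewrite !mxE; ring.
exact: cancel.
Qed.
End Fields.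

Lemma normal_components_frame i : components x p (e i) = delta_mx 0 i.
Proof. by rewrite -(normal_coord_field hx) const_field_rep. Qed.

(** The extending fields are constant in [chart_at p]; they are smooth on the overlap with the
    normal chart, and [curvature_rep0] sees only their values at [p]. *)
Lemma curvature_at_normal i h j :
  components x p (curvature_at D p (e i) (e h) (e j)) =
  dform (delta_mx 0 i) (delta_mx 0 j) (delta_mx 0 h) -
  dform (delta_mx 0 h) (delta_mx 0 j) (delta_mx 0 i).
Proof.
have ac := chart_at_atlas p; have cp := chart_at_cdom p.
set c := chart_at p in ac cp.
pose O := cdom c `&` cdom x.
have oO : open O by apply: openI; exact: cdom_open.
have sc a : smooth_vector_field O (const_field c a).
  by apply: (smooth_vector_field_sub oO _ (const_field_smooth a ac)) => q [].
have Ox : O `<=` cdom x by move=> q [].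
have Op : O p by split.
rewrite /curvature_at /= (curvature_rep0 oO Ox Op (sc _) (sc _) (sc _)).
have E a : components x p (const_field c (e a) p) = delta_mx 0 a.
  rewrite -normal_components_frame; congr (components x p _).
  by rewrite /const_field of_componentsE // transition_id.
by rewrite !E.
Qed.
End Curvature.

(* [A l i j k] stands for the derivative d_l Gamma_ij^k at the origin. *)
Lemma hessian_of_christoffel (R : realFieldType) (I : Type) (A : I -> I -> I -> I -> R) a b i j :
  (forall l i j k, A l i j k = A l j i k) ->
  (forall l i j k, A l i j k + A i j l k + A j l i k = 0) ->
  (forall h k i j, A h k i j + A h k j i = A k h i j + A k h j i) ->
  A b a i j + A b a j i =
  - 3^-1 * (A a i j b - A i a j b) + - 3^-1 * (A b i j a - A i b j a).
Proof.
move=> As Ac Ah.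
have := Ac a b i j; have := Ac a b j i; have := Ac a i j b; have := Ac b i j a.
have := Ah a b i j; have := Ah a i b j; have := Ah a j b i.
have := Ah b i a j; have := Ah b j a i; have := Ah i j a b.
rewrite !(As _ b a) !(As _ i a) !(As _ i b) !(As _ j a) !(As _ j b) !(As _ j i).
lra.
Qed.

(** * Derivatives of the metric coefficients at the origin *)

Section Metric.
Variables (R : realType) (n : nat) (M : smooth_manifold R n) (D : connection M).
Variables (g : riemannian_metric M) (hD : levi_civita g D).
Variables (p : M) (e : 'I_n -> 'rV[R]_n) (x : chart R n M).
Hypotheses (he : orthonormal_basis g p e) (hx : normal_coordinates D p e x).
Implicit Types (y z : 'rV[R]_n).

Let ax : atlas x. Proof. by case: hx. Qed.
Let xdom : cdom x p. Proof. by case: hx. Qed.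
Let xp : x p = 0. Proof. by case: hx. Qed.
Let Dtf := torsion_free hD.
Let oU : open (x @` cdom x). Proof. exact: cimg_open. Qed.
Let U0 : (x @` cdom x) 0. Proof. exact: normal_image0 hx. Qed.

Local Notation G := (metric_coefficient g x).
Local Notation dform := (form_derive D x).

Lemma metric_suml q I (r : seq I) (a : I -> R) (X : I -> 'rV[R]_n) w :
  g q (\sum_(i <- r) a i *: X i) w = \sum_(i <- r) a i * g q (X i) w.
Proof.
elim: r => [|i r IH]; last by rewrite !big_cons metric_linear IH.
rewrite !big_nil; have := metric_linear g q (-1) 0 0 w.
by rewrite scaler0 addr0 mulN1r addNr.
Qed.

Lemma metric_coefficient_smooth i j : smooth_on (x @` cdom x) (G i j).
Proof. by have := metric_smooth g ax i j ax; rewrite setIid. Qed.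

Lemma metric_coefficient0 i j : G i j 0 = (i == j)%:R.
Proof.
rewrite /metric_coefficient /= -xp cmapK // !(normal_coord_field hx).
exact: he.1.
Qed.

(** Metric compatibility on the coordinate fields, established on the whole image of the chart
    because it is differentiated once more at 0. *)
Lemma metric_coefficient_pderive i j k z : (x @` cdom x) z ->
  pderive k (G i j) z = \sum_l (christoffel D x k i z 0 l * G l j z
                              + christoffel D x k j z 0 l * G l i z).
Proof.
move=> Uz; have xz := cdom_cinv Uz; have zE := cinvK Uz.
set q := cinv x z in xz zE.
have oc := @cdom_open _ _ _ x.
have sc a : smooth_vector_field (cdom x) (coord_field x a) by exact: const_field_smooth.
have := metric_compatible hD oc (sc k) (sc i) (sc j) (mem_set xz).
have dG : differentiable ((fun r => g r (coord_field x i r) (coord_field x j r)) \o cinv x) (x q).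
  by rewrite zE; exact: smooth_on_differentiable (metric_coefficient_smooth i j) _ Uz.
rewrite (vderiveE _ ax xz dG) const_field_rep // zE => E.
apply: etrans E _; rewrite (Defs.metric_sym g q (coord_field x i q)).
have DE a b : D (coord_field x a) (coord_field x b) q =
    \sum_l christoffel D x a b z 0 l *: coord_field x l q.
  by rewrite {1}(vector_coord (D _ _ q) ax xz).
by rewrite !DE !metric_suml -big_split.
Qed.

Lemma metric_coefficient_pderive0 i j k : pderive k (G i j) 0 = 0.
Proof.
rewrite metric_coefficient_pderive // big1 // => l _.
by rewrite !(christoffel0 hx Dtf) mxE !mul0r addr0.
Qed.

(** In the derivative of each product Gamma^l g_lj at 0, the term with Gamma undifferentiated
    vanishes and g_lj is the identity matrix. *)
Lemma metric_coefficient_pderive2 i j k h : pderive h (pderive k (G i j)) 0 =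
  dform (delta_mx 0 k) (delta_mx 0 i) (delta_mx 0 h) 0 j +
  dform (delta_mx 0 k) (delta_mx 0 j) (delta_mx 0 h) 0 i.
Proof.
rewrite (pderive_ext h oU (metric_coefficient_pderive i j k) U0).
have dc a b l : differentiable (fun z => christoffel D x a b z 0 l) 0.
  exact: ((differentiable_rowP _ _).1 (christoffel_differentiable0 hx a b) l).
have dG a b : differentiable (G a b) 0.
  exact: smooth_on_differentiable (metric_coefficient_smooth a b) _ U0.
have P a b l m : derivable ((fun z => christoffel D x a b z 0 l) * G l m) 0 (delta_mx 0 h) /\
   'D_(delta_mx 0 h) ((fun z => christoffel D x a b z 0 l) * G l m) 0 =
   dform (delta_mx 0 a) (delta_mx 0 b) (delta_mx 0 h) 0 l * (l == m)%:R.
  have d1 := diff_derivable (v := delta_mx 0 h) (dc a b l).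
  have d2 := diff_derivable (v := delta_mx 0 h) (dG l m).
  split; first exact: (derivableM d1 d2).
  rewrite (deriveM d1 d2) (christoffel0 hx Dtf) mxE scale0r add0r metric_coefficient0.
  rewrite form_derive_delta (derive_rowd _ l (christoffel_differentiable0 hx a b)).
  exact: mulrC.
have -> : (fun z => \sum_l (christoffel D x k i z 0 l * G l j z
                           + christoffel D x k j z 0 l * G l i z)) =
   \sum_l ((fun z => christoffel D x k i z 0 l) * G l j
           + (fun z => christoffel D x k j z 0 l) * G l i).
  by apply/funext => z; rewrite fct_sumE.
rewrite /pderive derive_sum => [|l]; last exact: derivableD (P _ _ _ _).1 (P _ _ _ _).1.
have S (F : 'I_n -> R) m : \sum_l F l * (l == m)%:R = F m.
  rewrite (bigD1 m) //= eqxx mulr1 big1 ?addr0 // => l /negPf ->; exact: mulr0.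
apply: etrans _ (congr2 +%R (S (fun l => dform (delta_mx 0 k) (delta_mx 0 i) (delta_mx 0 h) 0 l) j)
  (S (fun l => dform (delta_mx 0 k) (delta_mx 0 j) (delta_mx 0 h) 0 l) i)); rewrite -big_split.
apply: eq_bigr => l _.
by rewrite (deriveD (P k i l j).1 (P k j l i).1) (P k i l j).2 (P k j l i).2.
Qed.

Lemma curvature_component_normal i h j k : curvature_component g D p e i h j k =
  dform (delta_mx 0 i) (delta_mx 0 j) (delta_mx 0 h) 0 k -
  dform (delta_mx 0 h) (delta_mx 0 j) (delta_mx 0 i) 0 k.
Proof.
rewrite /curvature_component (vector_coord (curvature_at _ _ _ _ _) ax xdom).
rewrite (curvature_at_normal hx Dtf) metric_suml (bigD1 k) //=.
rewrite (normal_coord_field hx) he.1 eqxx mulr1 big1 ?addr0 => [|l /negPf lk].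
  by rewrite !mxE.
by rewrite (normal_coord_field hx) he.1 lk mulr0.
Qed.

Lemma metric_coefficient_hessian i j a b : pderive b (pderive a (G i j)) 0 =
  - 3^-1 * curvature_component g D p e i a j b + - 3^-1 * curvature_component g D p e i b j a.
Proof.
rewrite metric_coefficient_pderive2 !curvature_component_normal.
apply: (hessian_of_christoffel
  (A := fun l i j k => dform (delta_mx 0 i) (delta_mx 0 j) (delta_mx 0 l) 0 k)).
- by move=> l i' j' k; rewrite (form_derive_sym hx Dtf).
- by move=> l i' j' k; exact: (form_derive_cyclic hx Dtf).
(* In terms of the curvature, this symmetry of the second derivatives of g says R_khij + R_khji =
   0. *)
- move=> h k i' j'; apply: etrans (esym (metric_coefficient_pderive2 i' j' k h)) _.
  apply: etrans _ (metric_coefficient_pderive2 i' j' h k).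
  exact: smooth_on_schwarz oU (metric_coefficient_smooth i' j') U0.
Qed.
End Metric.

Theorem theorem6p11 (R : realType) (n : nat) (M : smooth_manifold R n)
    (g : riemannian_metric M) (D : connection M) (hD : levi_civita g D)
    (p : M) (e : 'I_n -> 'rV[R]_n) (he : orthonormal_basis g p e)
    (x : chart R n M) (hx : normal_coordinates D p e x) (i j : 'I_n) :
  (fun y : 'rV[R]_n =>
     metric_coefficient g x i j y
     - ((i == j)%:R
        - 3^-1 * \sum_(h < n) \sum_(k < n)
                   curvature_component g D p e i h j k * y 0 h * y 0 k))
  =O_ (0 : 'rV[R]_n) (fun y : 'rV[R]_n => `|y| ^+ 3).
Proof.
have [ax _ _ _] := hx.
have oU := @cimg_open _ _ _ x.
have [C HC] := taylor2
  (C := fun h k => - 3^-1 * curvature_component g D p e i h j k) oU (normal_image0 hx)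
  (metric_coefficient_smooth g hx i j) (metric_coefficient0 he hx i j)
  (metric_coefficient_pderive0 hD hx i j)
  (metric_coefficient_hessian hD he hx i j).
(* [C] may have any sign, whereas the constant must be positive here. *)
apply/eqO_exP; exists (`|C| + 1); first by rewrite ltr_wpDl.
move: HC; apply: filterS => y h.
rewrite [X in _ <= _ * X]ger0_norm ?exprn_ge0 //.
apply: (@le_trans _ _ (C * `|y| ^+ 3)); last first.
  by rewrite ler_wpM2r ?exprn_ge0 // (le_trans (ler_norm C)) // lerDl.
suff -> : (i == j)%:R - 3^-1 * \sum_h \sum_k
      curvature_component g D p e i h j k * y 0 h * y 0 k =
    (i == j)%:R + \sum_h \sum_k
      - 3^-1 * curvature_component g D p e i h j k * (y 0 h * y 0 k) by [].
rewrite -mulNr mulr_sumr; congr (_ + _); apply: eq_bigr => a _; rewrite mulr_sumr.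
by apply: eq_bigr => b _; rewrite !mulrA.
Qed.
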